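(* Let $k\le n$ be positive integers and let $\lambda$ be a partition of $k$. The set of monomials $\mathcal{A}_{n,\lambda}$ represents a $\mathbb{Q}$-basis of $R_{n,\lambda}\cong\mathbb{Q}[\overline{O}_{n,\lambda'}\cap\mathfrak{t}]$ (where the isomorphism sends $x_i$ to $x_{i,i}$).
   Context: For a partition $\lambda$ of $k$, $\lambda'$ denotes the conjugate partition, $\lambda'_j=\#\{i:\lambda_i\ge j\}$, padded by zeros. Let $\mathbf{x}_n=\{x_1,\dots,x_n\}$. For $S\subseteq\mathbf{x}_n$ and $d\ge1$, $e_d(S)$ is the sum of all squarefree monomials of degree $d$ in the variables in $S$ (so $e_d(S)=0$ if $d>|S|$). For $0\le m\le n$ let $p^n_m(\lambda)=\lambda'_n+\lambda'_{n-1}+\dots+\lambda'_{n-m+1}$. Define $$I_{n,\lambda}=\langle e_d(S):S\subseteq\mathbf{x}_n,\ d>|S|-p^n_{|S|}(\lambda)\rangle,\qquad R_{n,\lambda}=\mathbb{Q}[\mathbf{x}_n]/I_{n,\lambda}.$$ Let $\mathfrak{gl}_n$ be the space of $n\times n$ matrices over $\mathbb{Q}$ with coordinate ring $\mathbb{Q}[x_{i,j}:1\le i,j\le n]$. For a partition $\mu$ of $k\le n$, the Eisenbud–Saltman rank variety is $\overline{O}_{n,\mu}=\{X\in\mathfrak{gl}_n:\dim\ker X^d\ge\mu'_1+\dots+\mu'_d,\ d=1,\dots,n\}$, with defining (vanishing) ideal $I(\overline{O}_{n,\mu})$. Let $\mathfrak{t}$ be the set of diagonal matrices, with ideal $I(\mathfrak{t})=\langle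 x_{i,j}:i\ne j\rangle$; $\mathbb{Q}[\overline{O}_{n,\mu}\cap\mathfrak{t}]=\mathbb{Q}[x_{i,j}]/(I(\overline{O}_{n,\mu})+I(\mathfrak{t}))$. A shuffle of several finite sequences is an interleaving of them in which the entries of each sequence appear in their original left-to-right order. For $1\le j\le\lambda_1$ let $\beta^j(\lambda)=(0,1,\dots,\lambda'_j-1)$. An $(n,\lambda)$-staircase is a shuffle of $\beta^1(\lambda),\dots,\beta^{\lambda_1}(\lambda)$ and the sequence $(\infty^{n-k})$ consisting of $n-k$ copies of the symbol $\infty$ (larger than every integer). $\mathcal{C}_{n,\lambda}$ is the set of sequences $(a_1,\dots,a_n)$ of (finite) nonnegative integers for which there is an $(n,\lambda)$-staircase $(\gamma_1,\dots,\gamma_n)$ with $a_i\le\gamma_i$ for all $i$, and $\mathcal{A}_{n,\lambda}=\{x_1^{a_1}\cdots x_n^{a_n}:(a_1,\dots,a_n)\in\mathcal{C}_{n,\lambda}\}$. ''Represents a basis'' means the images of these monomials in the quotient are distinct and form a basis. *)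

(* Defs.v *)
From HB Require Import structures.
From mathcomp Require Import all_boot all_algebra.
From mathcomp Require Import boolp.
From mathcomp Require Import mpoly.

Set Implicit Arguments.
Unset Strict Implicit.
Unset Printing Implicit Defensive.

Import GRing.Theory.
Local Open Scope ring_scope.
Local Open Scope quotient_scope.

(* mathcomp's [idealr] only covers proper ideals; here an ideal may be the
   whole ring, so that [ideal_gen] below is total. *)
Record ideal (A : comPzRingType) := Ideal {
  ideal_mem :> A -> Prop;
  ideal_mem0 : ideal_mem 0;
  ideal_memD : forall x y, ideal_mem x -> ideal_mem y -> ideal_mem (x + y);
  ideal_memM : forall a x, ideal_mem x -> ideal_mem (a * x)
}.

Section IdealOperations.
Variable A : comPzRingType.

Definition ideal_gen_mem (G : A -> Prop) (x : A) : Prop :=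
  exists2 s : seq (A * A),
    (forall cg, cg \in s -> G cg.2) & x = \sum_(cg <- s) cg.1 * cg.2.

Lemma ideal_gen_mem0 G : ideal_gen_mem G 0.
Proof. by exists [::]; rewrite ?big_nil. Qed.

Lemma ideal_gen_memD G x y :
  ideal_gen_mem G x -> ideal_gen_mem G y -> ideal_gen_mem G (x + y).
Proof.
move=> [s sG ->] [t tG ->]; exists (s ++ t); last by rewrite big_cat.
by move=> cg; rewrite mem_cat => /orP[/sG|/tG].
Qed.

Lemma ideal_gen_memM G a x : ideal_gen_mem G x -> ideal_gen_mem G (a * x).
Proof.
move=> [s sG ->]; exists [seq (a * cg.1, cg.2) | cg <- s].
  by move=> _ /mapP[cg /sG Gcg ->].
by rewrite big_map mulr_sumr; apply: eq_bigr => cg _; rewrite mulrA.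
Qed.

Definition ideal_gen (G : A -> Prop) : ideal A :=
  Ideal (ideal_gen_mem0 G) (@ideal_gen_memD G) (@ideal_gen_memM G).

Definition ideal_sum_mem (I J : ideal A) (x : A) : Prop :=
  exists y z, [/\ I y, J z & x = y + z].

Lemma ideal_sum_mem0 I J : ideal_sum_mem I J 0.
Proof. by exists 0, 0; rewrite addr0; split=> //; apply: ideal_mem0. Qed.

Lemma ideal_sum_memD I J x y :
  ideal_sum_mem I J x -> ideal_sum_mem I J y -> ideal_sum_mem I J (x + y).
Proof.
move=> [x1 [x2 [Ix Jx ->]]] [y1 [y2 [Iy Jy ->]]].
exists (x1 + y1), (x2 + y2); rewrite addrACA.
by split=> //; apply: ideal_memD.
Qed.

Lemma ideal_sum_memM I J a x : ideal_sum_mem I J x -> ideal_sum_mem I J (a * x).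
Proof.
move=> [x1 [x2 [Ix Jx ->]]]; exists (a * x1), (a * x2).
by rewrite mulrDr; split=> //; apply: ideal_memM.
Qed.

Definition ideal_sum (I J : ideal A) : ideal A :=
  Ideal (ideal_sum_mem0 I J) (@ideal_sum_memD I J) (@ideal_sum_memM I J).

Definition idealb (I : ideal A) : {pred A} := fun x => `[< I x >].

Lemma idealb_zmod_closed I : zmod_closed (idealb I).
Proof.
split=> [|x y /asboolP Ix /asboolP Iy]; apply/asboolP; first exact: ideal_mem0.
by apply: ideal_memD => //; rewrite -mulN1r; apply: ideal_memM.
Qed.

HB.instance Definition _ I :=
  GRing.isZmodClosed.Build A (idealb I) (idealb_zmod_closed I).

End IdealOperations.

(* The quotient algebra A / I, as a commutative ring and a K-module.  It is only
   a [pzRing], since I may be the unit ideal. *)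
Definition quot_alg (K : fieldType) (A : comAlgType K) (I : ideal A) : Type :=
  @Quotient.quot A (idealb I).

Section QuotientAlgebra.
Variables (K : fieldType) (A : comAlgType K) (I : ideal A).

HB.instance Definition _ := GRing.Zmodule.on (quot_alg I).

Definition quot_pi (x : A) : quot_alg I := \pi_(@Quotient.quot A (idealb I)) x.

Lemma quot_piP x y : quot_pi x = quot_pi y <-> I (x - y).
Proof.
split=> [/eqP|Ixy]; first by rewrite /quot_pi -Quotient.idealrBE => /asboolP.
by apply/eqP; rewrite /quot_pi -Quotient.idealrBE; apply/asboolP.
Qed.

Definition quot_repr (q : quot_alg I) : A :=
  repr (q : @Quotient.quot A (idealb I)).

Lemma quot_reprK : cancel quot_repr quot_pi.
Proof. by move=> q; rewrite /quot_pi /quot_repr reprK. Qed.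

Lemma quot_pi_is_zmod_morphism : zmod_morphism quot_pi.
Proof. by move=> x y; rewrite /quot_pi raddfB. Qed.

HB.instance Definition _ :=
  GRing.isZmodMorphism.Build A (quot_alg I) quot_pi quot_pi_is_zmod_morphism.

Definition quot_mul (p q : quot_alg I) : quot_alg I :=
  quot_pi (quot_repr p * quot_repr q).

Definition quot_scale (c : K) (q : quot_alg I) : quot_alg I :=
  quot_pi (c *: quot_repr q).

Lemma quot_pi_mul x y : quot_mul (quot_pi x) (quot_pi y) = quot_pi (x * y).
Proof.
apply/quot_piP; set x' := quot_repr _; set y' := quot_repr _.
have Ix : I (x' - x) by apply/quot_piP; rewrite quot_reprK.
have Iy : I (y' - y) by apply/quot_piP; rewrite quot_reprK.
have -> : x' * y' - x * y = y' * (x' - x) + x * (y' - y).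
  by rewrite !mulrBr (mulrC y' x') (mulrC y' x) addrA subrK.
by apply: ideal_memD; apply: ideal_memM.
Qed.

Lemma quot_pi_scale c x : quot_scale c (quot_pi x) = quot_pi (c *: x).
Proof.
apply/quot_piP; rewrite -scalerBr -mulr_algl; apply: ideal_memM.
by apply/quot_piP; rewrite quot_reprK.
Qed.

Lemma quot_mulA : associative quot_mul.
Proof.
move=> p q r; rewrite -(quot_reprK p) -(quot_reprK q) -(quot_reprK r).
by rewrite !quot_pi_mul mulrA.
Qed.

Lemma quot_mulC : commutative quot_mul.
Proof. by move=> p q; rewrite /quot_mul mulrC. Qed.

Lemma quot_mul1 : left_id (quot_pi 1) quot_mul.
Proof. by move=> p; rewrite -(quot_reprK p) quot_pi_mul mul1r. Qed.

Lemma quot_mulDl : left_distributive quot_mul +%R.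
Proof.
move=> p q r; rewrite -(quot_reprK p) -(quot_reprK q) -(quot_reprK r).
by rewrite -raddfD !quot_pi_mul mulrDl raddfD.
Qed.

HB.instance Definition _ := GRing.Zmodule_isComPzRing.Build (quot_alg I)
  quot_mulA quot_mulC quot_mul1 quot_mulDl.

Lemma quot_pi_is_monoid_morphism : monoid_morphism quot_pi.
Proof. by split=> // x y; rewrite -quot_pi_mul. Qed.

HB.instance Definition _ := GRing.isMonoidMorphism.Build A (quot_alg I)
  quot_pi quot_pi_is_monoid_morphism.

Lemma quot_scaleA a b q :
  quot_scale a (quot_scale b q) = quot_scale (a * b) q.
Proof. by rewrite -(quot_reprK q) !quot_pi_scale scalerA. Qed.

Lemma quot_scale1 : left_id 1 quot_scale.
Proof. by move=> q; rewrite -(quot_reprK q) quot_pi_scale scale1r. Qed.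

Lemma quot_scaleDr : right_distributive quot_scale +%R.
Proof.
move=> c p q; rewrite -(quot_reprK p) -(quot_reprK q).
by rewrite -raddfD !quot_pi_scale scalerDr raddfD.
Qed.

Lemma quot_scaleDl q : {morph quot_scale^~ q : a b / a + b}.
Proof.
by move=> a b; rewrite -(quot_reprK q) !quot_pi_scale scalerDl raddfD.
Qed.

HB.instance Definition _ := GRing.Zmodule_isLmodule.Build K (quot_alg I)
  quot_scaleA quot_scale1 quot_scaleDr quot_scaleDl.

Lemma quot_pi_is_scalable : scalable quot_pi.
Proof. by move=> c x; rewrite -quot_pi_scale. Qed.

HB.instance Definition _ := GRing.isScalable.Build K A (quot_alg I) *:%R
  quot_pi quot_pi_is_scalable.

End QuotientAlgebra.

Definition represents_basis (K : fieldType) (A : comAlgType K) (I : ideal A)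
    (M : A -> Prop) : Prop :=
  [/\ (* distinct images *)
      forall x y, M x -> M y -> quot_pi I x = quot_pi I y -> x = y,
      (* linear independence *)
      forall (s : seq A) (c : A -> K), uniq s -> (forall x, x \in s -> M x) ->
        \sum_(x <- s) c x *: quot_pi I x = 0 -> forall x, x \in s -> c x = 0
    & (* generation *)
      forall q : quot_alg I, exists (s : seq A) (c : A -> K),
        (forall x, x \in s -> M x) /\ q = \sum_(x <- s) c x *: quot_pi I x].

(* Partitions are weakly decreasing sequences of positive integers; padding by
   zeros is the default value of [nth 0]. *)
Definition is_partition (k : nat) (la : seq nat) : bool :=
  [&& sorted geq la, 0%N \notin la & sumn la == k].

(* Indices are shifted by one: nth 0 (conj_part la) j is lambda'_{j+1}. *)
Definition conj_part (la : seq nat) : seq nat :=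
  mkseq (fun j => count (fun r => (j < r)%N) la) (head 0%N la).

(* p^n_m(lambda) = lambda'_n + ... + lambda'_{n-m+1} *)
Definition pnm (n m : nat) (la : seq nat) : nat :=
  (\sum_(n - m <= j < n) nth 0 (conj_part la) j)%N.

Definition esymS (n d : nat) (S : {set 'I_n}) : {mpoly rat[n]} :=
  \sum_(T : {set 'I_n} | (T \subset S) && (#|T| == d)) \prod_(i in T) 'X_i.

(* d > |S| - p^n_{|S|}(lambda), without truncated subtraction *)
Definition I_gens (n : nat) (la : seq nat) (g : {mpoly rat[n]}) : Prop :=
  exists (S : {set 'I_n}) (d : nat),
    [/\ (1 <= d)%N, (#|S| < d + pnm n #|S| la)%N & g = esymS d S].

Definition I_ideal (n : nat) (la : seq nat) : ideal {mpoly rat[n]} :=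
  ideal_gen (@I_gens n la).

Definition R_alg (n : nat) (la : seq nat) := quot_alg (I_ideal n la).

(* The coordinate ring of gl_n: x_{i,j} is the variable of index
   [mxvec_index i j] among n * n variables. *)
Definition glvar (n : nat) (i j : 'I_n) : {mpoly rat[n * n]} :=
  'X_(mxvec_index i j).

Definition gleval (n : nat) (X : 'M[rat]_n) (f : {mpoly rat[n * n]}) : rat :=
  f.@[fun i => mxvec X 0 i].

(* cokermx Y is the matrix of column vectors v with Y *m v = 0, so its rank is
   dim ker Y for the action on columns. *)
Definition rank_variety (n : nat) (mu : seq nat) (X : 'M[rat]_n) : Prop :=
  forall d : nat, (1 <= d <= n)%N ->
    (\sum_(j < d) nth 0 (conj_part mu) j <= \rank (cokermx (X ^+ d)))%N.

Section VanishingIdeal.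
Variables (n : nat) (V : 'M[rat]_n -> Prop).

Definition vanishing_mem (f : {mpoly rat[n * n]}) : Prop :=
  forall X, V X -> gleval X f = 0.

Lemma vanishing_mem0 : vanishing_mem 0.
Proof. by move=> X _; rewrite /gleval raddf0. Qed.

Lemma vanishing_memD f g :
  vanishing_mem f -> vanishing_mem g -> vanishing_mem (f + g).
Proof.
by move=> If Ig X VX; rewrite /gleval mevalD -!/(gleval _ _) If ?Ig ?addr0.
Qed.

Lemma vanishing_memM a f : vanishing_mem f -> vanishing_mem (a * f).
Proof.
by move=> If X VX; rewrite /gleval mevalM -!/(gleval _ _) If ?mulr0.
Qed.

Definition vanishing_ideal : ideal {mpoly rat[n * n]} :=
  Ideal vanishing_mem0 vanishing_memD vanishing_memM.

End VanishingIdeal.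

Definition diag_ideal (n : nat) : ideal {mpoly rat[n * n]} :=
  ideal_gen (fun g => exists i j : 'I_n, i != j /\ g = glvar i j).

Definition OT_ideal (n : nat) (mu : seq nat) : ideal {mpoly rat[n * n]} :=
  ideal_sum (vanishing_ideal (@rank_variety n mu)) (diag_ideal n).

Definition OT_alg (n : nat) (mu : seq nat) := quot_alg (OT_ideal n mu).

(* c records which of the sequences ss each entry of w comes from. *)
Definition is_shuffle (T : Type) (ss : seq (seq T)) (w : seq T) : Prop :=
  exists c : seq nat,
    [/\ size c = size w,
        all (fun j => j < size ss)%N c
      & forall j, (j < size ss)%N ->
          mask [seq i == j | i <- c] w = nth [::] ss j].

(* None stands for the symbol infinity. *)
Definition is_staircase (n : nat) (la : seq nat) (g : seq (option nat)) : Prop :=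
  is_shuffle
    (rcons [seq [seq Some a | a <- iota 0 l] | l <- conj_part la]
           (nseq (n - sumn la) None)) g.

Definition le_inf (a : nat) (b : option nat) : bool :=
  if b is Some b' then (a <= b')%N else true.

Definition C_set (n : nat) (la : seq nat) (a : 'X_{1..n}) : Prop :=
  exists2 g : n.-tuple (option nat),
    is_staircase n la g & forall i : 'I_n, le_inf (a i) (tnth g i).

Definition A_set (n : nat) (la : seq nat) (f : {mpoly rat[n]}) : Prop :=
  exists2 a : 'X_{1..n}, C_set la a & f = 'X_[a].

(* Main.v *)
Require Import Defs.
From HB Require Import structures.
From mathcomp Require Import all_boot all_algebra.
From mathcomp Require Import fingroup perm.
From mathcomp Require Import mpoly.
From mathcomp Require Import zify ring.
Set Implicit Arguments.
Unset Strict Implicit.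
Unset Printing Implicit Defensive.
Import GRing.Theory.
Local Open Scope ring_scope.

(** Write [h j] for the height of column [j] (counted from [0]) of the diagram
    of [la], [I] for [I_ideal n la], and [T] for the trace ideal, the set of
    restrictions to the diagonal matrices of the polynomials that vanish on the
    rank variety.  The coordinate ring of the intersection with the diagonal
    matrices is the quotient of [Q[x_1, ..., x_n]] by [T], so the theorem says
    that [I = T] and that the monomials below the staircases form a basis of the
    quotient.  This follows from three facts.

    - [I] is contained in [T] ([I_ideal_trace]).  Let [P] be the projection onto
      the coordinates in [S].  The coefficient of ['X^(n - d)] in the
      characteristic polynomial of [P X P] restricts, up to sign, to [e_d(S)] on
      the diagonal matrices.  If [X ^ D] has a large kernel, so has
      [(P X P) ^ D], the rank growing by at most [(D - 1) (n - #|S|)]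
      ([rank_compression]), hence a high power of ['X] divides the
      characteristic polynomial ([dvdp_char_poly_rank]).  The exponent
      [D = h (n - #|S|)] gives exactly the range of [d] in the definition of [I].

    - The monomials below the staircases span modulo [I] ([span_stairs]).  This
      is the Garsia-Procesi recursion on the last variable: multiplied by
      [x_n ^ i], the ideal of the diagram with one box less (taken from the last
      column of height greater than [i]) lies in [I] up to multiples of
      [x_n ^ (i + 1)].

    - The same monomials are independent modulo [T] ([C_set_independent]).  A
      staircase distributes the variables into columns and free variables.  For
      the ideal [C] generated by the elementary symmetric polynomials of positive
      degree of each column, taking a coefficient of the antisymmetrisation in
      the columns is a functional that vanishes on [C], and these functionals are
      triangular on monomials ([stair_functional_triangular]).  It remains to see
      that they vanish on [T] ([diag_restr_functional]).  Let [J] have ones at the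
      pairs of consecutive positions of a column.  In each column,
      multiplication by [t] on [Q[t] / (t ^ r)], written in the basis of the
      Newton polynomials of the [x_i], is [diag(x) + J] up to entries in [C].  So
      [diag(x) + J] is congruent modulo [C] to a matrix all of whose rational
      specialisations lie in the rank variety, and after conjugation by a
      diagonal matrix the same holds with entries [a ^ (l - i)] in the place of
      the ones of [J], for every [a <> 0].  A polynomial [f] vanishing on the rank
      variety thus takes a value in [C] at these matrices; the value is
      polynomial in [a], and at [a = 0] it is the restriction of [f].

    Since [I] is contained in [T], spanning modulo [I] and independence modulo
    [T] give [I = T] and the basis. *)

(** * Ranks and characteristic polynomials *)

Lemma char_poly_nilpotent (F : fieldType) (n d : nat) (Y : 'M[F]_n) :
  Y ^+ d = 0 -> char_poly Y = 'X^n.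
Proof.
move=> Yd; have comm : GRing.comm ('X%:M : 'M[{poly F}]_n) (map_mx polyC Y).
  exact: comm_scalar_mx.
have Yp : (map_mx polyC Y) ^+ d = 0 by rewrite -rmorphXn /= Yd map_mx0.
have Xp : ('X%:M : 'M[{poly F}]_n) ^+ d = ('X^d)%:M by rewrite -rmorphXn.
have := subrXX_comm d comm; rewrite Yp Xp subr0 => /(congr1 determinant).
rewrite -mulmxE det_mulmx det_scalar -exprM => e.
have /(@dvdp_exp_XsubCP _ _ 0) [k _] : char_poly Y %| ('X - 0%:P) ^+ (d * n).
  by rewrite subr0 e dvdp_mulIl.
rewrite subr0 => kE.
have {}kE : char_poly Y = 'X^k.
  by apply/eqP; rewrite -eqp_monic ?char_poly_monic ?monicXn.
have := size_char_poly Y; rewrite kE size_polyXn => -[->] //.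
Qed.

(** The characteristic polynomial of the restriction [Y1] of [Y] to a stable
    subspace, spanned by the rows of [V], divides that of [Y]. *)
Lemma char_poly_stable (F : fieldType) (r s n : nat) (Y : 'M[F]_n)
    (V : 'M[F]_(r, n)) (W : 'M[F]_(s, n)) (Y1 : 'M[F]_r) :
  (r + s = n)%N -> row_full (col_mx V W) -> V *m Y = Y1 *m V ->
  char_poly Y1 %| char_poly Y.
Proof.
move=> e; subst n => full VY; pose B := col_mx V W.
have Bu : B \in unitmx by rewrite -row_full_unit.
pose Z := B *m Y *m invmx B.
have ZB : Z *m B = B *m Y by rewrite /Z -mulmxA mulVmx ?mulmx1.
have VB : V *m invmx B = row_mx 1%:M 0.
  have: B *m invmx B = 1%:M by rewrite mulmxV.
  by rewrite mul_col_mx scalar_mx_block => /eq_col_mx[].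
have uZ : usubmx Z = row_mx Y1 0.
  rewrite /Z !mul_col_mx col_mxKu VY -mulmxA VB mul_mx_row mulmx1 mulmx0 //.
have -> : char_poly Y = char_poly Z.
  have h : map_mx polyC B *m char_poly_mx Y = char_poly_mx Z *m map_mx polyC B.
    rewrite mulmxBr mulmxBl -!map_mxM ZB scalar_mxC //.
  have := congr1 determinant h; rewrite !det_mulmx [RHS]mulrC.
  by apply: mulfI; rewrite det_map_mx polyC_eq0 -unitfE -unitmxE.
have -> : Z = block_mx Y1 0 (dlsubmx Z) (drsubmx Z).
  by rewrite -[LHS]submxK /ulsubmx /ursubmx uZ row_mxKl row_mxKr.
rewrite /char_poly /char_poly_mx map_block_mx map_mx0 scalar_mx_block.
by rewrite opp_block_mx add_block_mx oppr0 addr0 det_lblock dvdp_mulIl.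
Qed.

(** The kernel of [Y ^+ d] is stable, and [Y] is nilpotent on it. *)
Lemma dvdp_char_poly_rank (F : fieldType) (n d r : nat) (Y : 'M[F]_n) :
  (\rank (Y ^+ d) + r <= n)%N -> 'X^r %| char_poly Y.
Proof.
move=> rk; pose K := kermx (Y ^+ d).
have KY : (K *m Y <= K)%MS.
  by apply/sub_kermxP; rewrite -mulmxA mulmxE -exprS exprSr -mulmxE mulmxA mulmx_ker mul0mx.
pose V := row_base K; pose W := row_base (K^C)%MS.
have VYs : (V *m Y <= V)%MS.
  by rewrite eq_row_base (submx_trans _ KY) // submxMr // eq_row_base.
have [Y1 VY] := submxP VYs.
have rkK : \rank K = (n - \rank (Y ^+ d))%N by rewrite mxrank_ker.
have dvd : char_poly Y1 %| char_poly Y.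
  apply: (@char_poly_stable _ _ _ _ _ V W) => //.
    by rewrite mxrank_compl subnKC // rank_leq_row.
  rewrite -sub1mx -addsmxE (adds_eqmx (eq_row_base K) (eq_row_base K^C)%MS).
  by have := addsmx_compl_full K; rewrite -sub1mx.
apply: dvdp_trans dvd; rewrite (@char_poly_nilpotent _ _ d).
  by rewrite dvdp_exp2l // rkK; lia.
have VYi i : V *m Y ^+ i = Y1 ^+ i *m V.
  elim: i => [|i IH]; first by rewrite !expr0 mulmx1 mul1mx.
  by rewrite exprSr -mulmxE mulmxA IH -mulmxA VY mulmxA mulmxE -exprSr.
apply/(row_free_inj (row_base_free K)); rewrite mul0mx -/V -VYi.
by apply/sub_kermxP; rewrite eq_row_base.
Qed.

(** Compressing [X] by a projection [P] costs the rank of [1 - P] at each of the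
    [d - 1] inner occurrences of [P] in [(P X P) ^+ d]. *)
Lemma rank_compression (F : fieldType) (n d : nat) (P X : 'M[F]_n) :
  P *m P = P -> (0 < d)%N ->
  (\rank ((P *m X *m P) ^+ d)%R <=
     \rank (X ^+ d) + d.-1 * \rank (1%:M - P)%R)%N.
Proof.
move=> PP; case: d => // d _ /=; rewrite !mulmxE in PP *.
have step e i : (\rank (X ^+ e * (P * X) ^+ i)%R <=
    \rank (X ^+ (e + i)) + i * \rank (1%:M - P)%R)%N.
  elim: i e => [|i IH] e; first by rewrite expr0 mulr1 addn0 mul0n addn0.
  (* One inner [P] is traded for [1 - (1 - P)]. *)
  have -> : X ^+ e * (P * X) ^+ i.+1 =
     X ^+ e.+1 * (P * X) ^+ i - X ^+ e * ((1%:M - P) * (X * (P * X) ^+ i)).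
    rewrite exprS exprSr mulrBl mulrBr mul1r !mulrA opprB addrC subrK //.
  apply: leq_trans (mxrank_add _ _) _; rewrite mxrank_opp.
  have h : (\rank (X ^+ e * ((1%:M - P) * (X * (P * X) ^+ i)))%R <= \rank (1%:M - P)%R)%N.
    by apply: leq_trans (mxrankM_maxr _ _) _; apply: mxrankM_maxl.
  by have := IH e.+1; rewrite addSnnS; lia.
have -> : (P * X * P) ^+ d.+1 = P * X * (P * P * X) ^+ d * P.
  elim: d => [|d IH]; first by rewrite !expr1 expr0 mulr1.
  by rewrite exprSr IH [(P * P * X) ^+ _.+1]exprSr !mulrA.
rewrite PP; apply: leq_trans (mxrankM_maxl _ _) _.
rewrite -mulrA; apply: leq_trans (mxrankM_maxr _ _) _.
exact: step 1%N d.
Qed.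

Lemma rank_leq_card_rows (F : fieldType) (m n : nat) (A : 'M[F]_(m, n)) (T : {set 'I_m}) :
  (forall i, i \notin T -> row i A = 0) -> (\rank A <= #|T|)%N.
Proof.
move=> zr; have sub : (A <= \sum_(i in T) <<row i A>>)%MS.
  apply/row_subP => i; have [iT|/zr ->] := boolP (i \in T); last exact: sub0mx.
  by apply: (sumsmx_sup i) => //; rewrite genmxE.
apply: leq_trans (mxrankS sub) _; rewrite -sum1_card.
elim/big_rec2: _ => [|i y1 y2 _ IH]; first by rewrite mxrank0.
apply: leq_trans (mxrank_adds_leqif _ _) _; rewrite leq_add // mxrank_gen.
exact: rank_leq_row.
Qed.

(** * Elementary symmetric sums over subsets *)
Section ElementarySums.
Variables (R : comNzRingType) (I : finType) (a : I -> R).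

(** The elementary symmetric sum of degree [d] of the family [a] over [S]. *)
Definition esum (S : {set I}) (d : nat) : R :=
  \sum_(T : {set I} | (T \subset S) && (#|T| == d)) \prod_(i in T) a i.

Lemma esum0 (S : {set I}) : esum S 0 = 1.
Proof.
rewrite /esum (big_pred1 set0) ?big_set0 // => T /=.
by rewrite cards_eq0; case: eqP => [->|]; rewrite ?sub0set ?andbF.
Qed.

Lemma esum_gt (S : {set I}) d : (#|S| < d)%N -> esum S d = 0.
Proof.
move=> lt; rewrite /esum big_pred0 // => T; apply/negP => /andP[/subset_leq_card].
by rewrite leqNgt => + /eqP Td; rewrite Td lt.
Qed.

Lemma esumU1 (S : {set I}) x d : x \notin S ->
  esum (x |: S) d.+1 = esum S d.+1 + a x * esum S d.
Proof.
move=> xS; rewrite /esum (bigID (fun T : {set I} => x \in T)) /= addrC; congr (_ + _).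
  by apply: eq_bigl => T; rewrite -[in RHS](setU1K xS) subsetD1 andbAC.
rewrite mulr_sumr (reindex_onto (fun T => x |: T) (fun T => T :\ x)) /=; last first.
  by move=> T /andP[_ xT]; rewrite setD1K.
have key T : ((x |: T \subset x |: S) && (#|x |: T| == d.+1) && (x \in x |: T)
   && ((x |: T) :\ x == T)) = (T \subset S) && (#|T| == d).
  rewrite setU11 andbT; case xT: (x \in T).
    have -> : (T \subset S) = false.
      by apply/negP => /subsetP/(_ _ xT); rewrite (negbTE xS).
    rewrite /= [X in _ && X](_ : _ = false) ?andbF //.
    by apply/negP => /eqP/setP/(_ x); rewrite setD11 xT.
  rewrite setU1K ?xT // eqxx andbT cardsU1 xT add1n eqSS; congr (_ && _).
  apply/idP/idP => [/subsetP sTS|sTS]; last exact: setUS.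
  apply/subsetP => y yT; have := sTS y; rewrite !inE yT orbT => /(_ isT).
  by case/orP => // /eqP e; rewrite e xT in yT.
apply: eq_big => [T|T] //.
rewrite key => /andP[TS _]; rewrite big_setU1 //=.
by apply: contra xS => /(subsetP TS).
Qed.

Lemma coef_prod_XsubC_set (S : {set I}) d k : (k + d = #|S|)%N ->
  (\prod_(i in S) ('X - (a i)%:P))`_k = (-1) ^+ d * esum S d.
Proof.
move: {2}#|S| (erefl #|S|) => m; elim: m S d k => [|m IH] S d k Sm e.
  have [-> ->] : k = 0%N /\ d = 0%N by lia.
  by move/eqP: Sm; rewrite cards_eq0 => /eqP ->; rewrite big_set0 coef1 esum0 mulr1.
have [x xS] : exists x, x \in S by apply/set0Pn; rewrite -card_gt0 Sm.
pose S' := S :\ x; have SE : S = x |: S' by rewrite setD1K.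
have xS' : x \notin S' by rewrite setD11.
have S'm : #|S'| = m by move: Sm; rewrite SE cardsU1 xS' => -[].
rewrite SE big_setU1 //= mulrBl coefB coefXM coefCM.
case: d e => [|d] e.
  have -> : k = m.+1 by lia.
  rewrite /= (IH S' 0%N m) ?addn0 // !esum0 mulr1.
  rewrite [X in _ - _ * X]nth_default ?mulr0 ?subr0 //.
  apply: leq_trans (size_poly_prod_leq _ _) _.
  rewrite (eq_bigr (fun=> 2%N)) => [|i _]; last by rewrite size_XsubC.
  rewrite sum_nat_const S'm; lia.
rewrite esumU1 // (IH S' d k) ?S'm //; last by lia.
case: k e => [|k] e /=.
  rewrite [esum S' d.+1]esum_gt ?S'm; last by lia.
  by rewrite exprS; ring.
rewrite (IH S' d.+1 k) ?S'm //; last by lia.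
by rewrite exprS; ring.
Qed.
End ElementarySums.

Lemma esum_imset (R : comNzRingType) (I J : finType) (a : J -> R) (f : I -> J)
    (S : {set I}) d : injective f -> esum a (f @: S) d = esum (a \o f) S d.
Proof.
move=> injf; move: {2}#|S| (erefl #|S|) => m; elim: m S d => [|m IH] S [|d] Sm.
- by rewrite !esum0.
- by rewrite !esum_gt ?card_imset ?Sm.
- by rewrite !esum0.
have [x xS] : exists x, x \in S by apply/set0Pn; rewrite -card_gt0 Sm.
have xS' : x \notin S :\ x by rewrite setD11.
have S'm : #|S :\ x| = m by move: Sm; rewrite -(setD1K xS) cardsU1 xS' setD1K // => -[].
rewrite -(setD1K xS) imsetU1 esumU1 ?mem_imset // esumU1 //.
by rewrite !IH.
Qed.

Lemma rmorph_esum (R R' : comNzRingType) (f : {rmorphism R -> R'}) (I : finType)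
    (a : I -> R) S d : f (esum a S d) = esum (f \o a) S d.
Proof.
by rewrite raddf_sum; apply: eq_bigr => T _; apply: rmorph_prod.
Qed.

Lemma esymSE n d (S : {set 'I_n}) : esymS d S = esum (fun i => 'X_i) S d.
Proof. by []. Qed.

(** * Evaluation at matrices, and sums of principal minors *)
(** The value of a polynomial in the matrix entries at a matrix with entries in
    a ring [A], the coefficients being sent to [A] by [io]. *)
Definition mxeval n (A : comNzRingType) (io : {rmorphism rat -> A}) (M : 'M[A]_n) :
  {rmorphism {mpoly rat[n * n]} -> A} := mmap io (fun e => mxvec M 0 e).

Lemma mxeval_glvar n (A : comNzRingType) (io : {rmorphism rat -> A}) (M : 'M[A]_n) i j :
  mxeval io M (glvar i j) = M i j.
Proof. by rewrite /mxeval /= mmapX mmap1U mxvecE. Qed.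

Lemma mxevalE n (A : comNzRingType) (io : {rmorphism rat -> A}) (M : 'M[A]_n) f :
  mxeval io M f = \sum_(m <- msupp f) io f@_m * \prod_e (mxvec M 0 e) ^+ m e.
Proof. by []. Qed.

Lemma rmorph_mxeval n (A B : comNzRingType) (io : {rmorphism rat -> A})
    (io' : {rmorphism rat -> B}) (phi : {rmorphism A -> B}) (M : 'M[A]_n) f :
  phi \o io =1 io' -> phi (mxeval io M f) = mxeval io' (map_mx phi M) f.
Proof.
move=> e; rewrite !mxevalE raddf_sum; apply: eq_bigr => m _ /=.
rewrite [LHS]rmorphM /= -[phi _]/((phi \o io) _) e; congr (_ * _).
rewrite rmorph_prod; apply: eq_bigr => c _.
by rewrite rmorphXn /= -map_mxvec mxE.
Qed.

Lemma glevalE n (X : 'M[rat]_n) f : gleval X f = mxeval idfun X f.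
Proof. by []. Qed.

(** Restriction of polynomials to the diagonal matrices. *)
Definition diag_restr n : {rmorphism {mpoly rat[n * n]} -> {mpoly rat[n]}} :=
  mxeval (@mpolyC n rat) (diag_mx (\row_i 'X_i)).

Definition generic_mx n : 'M[{mpoly rat[n * n]}]_n := \matrix_(i, j) glvar i j.

(** The projection onto the coordinates in [S]. *)
Definition coord_proj (R : pzRingType) n (S : {set 'I_n}) : 'M[R]_n :=
  diag_mx (\row_i (i \in S)%:R).

(** The coefficient of ['X^(n - d)] in the characteristic polynomial of the
    generic matrix compressed to the coordinates in [S]: up to sign, the sum of
    the principal [d]-minors supported in [S]. *)
Definition minor_sum n (S : {set 'I_n}) d : {mpoly rat[n * n]} :=
  (char_poly (coord_proj _ S *m generic_mx n *m coord_proj _ S))`_(n - d).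

Lemma map_coord_proj (R R' : nzRingType) (f : {rmorphism R -> R'}) n (S : {set 'I_n}) :
  map_mx f (coord_proj R S) = coord_proj R' S.
Proof.
by rewrite map_diag_mx; congr diag_mx; apply/rowP => i; rewrite !mxE rmorph_nat.
Qed.

Lemma mxeval_minor_sum n (A : comNzRingType) (io : {rmorphism rat -> A}) (M : 'M[A]_n) S d :
  mxeval io M (minor_sum S d) = (char_poly (coord_proj _ S *m M *m coord_proj _ S))`_(n - d).
Proof.
rewrite -coef_map map_char_poly !map_mxM !map_coord_proj.
have -> // : map_mx (mxeval io M) (generic_mx n) = M.
by apply/matrixP => i j; rewrite !mxE mxeval_glvar.
Qed.

Lemma gleval_minor_sum n (X : 'M[rat]_n) (S : {set 'I_n}) (D d : nat) :
  (0 < D)%N -> (d <= n)%N ->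
  (#|S| + \rank (X ^+ D)%R + D * (n - #|S|) < n + d)%N ->
  gleval X (minor_sum S d) = 0.
Proof.
move=> D0 dn lt; rewrite glevalE mxeval_minor_sum.
set P := coord_proj _ S.
have PP : P *m P = P.
  rewrite /P mulmx_diag; congr diag_mx; apply/rowP => i; rewrite !mxE.
  by case: (i \in S); rewrite ?mulr1 ?mulr0.
have rP : (\rank (1%:M - P)%R <= n - #|S|)%N.
  have -> : 1%:M - P = coord_proj _ (~: S).
    apply/matrixP => i j; rewrite !mxE inE; case: eqP => // _.
    by case: (i \in S); rewrite /= ?subrr ?subr0.
  have -> : (n - #|S|)%N = #|~: S| by have := cardsC S; rewrite card_ord; lia.
  apply: rank_leq_card_rows => i iS; apply/rowP => j; rewrite !mxE (negbTE iS).
  by rewrite mul0rn.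
have rk := leq_trans (rank_compression X PP D0) (leq_add (leqnn _) (leq_mul (leqnn _) rP)).
have Sn : (#|S| <= n)%N by rewrite -[n in (_ <= n)%N]card_ord max_card.
have /dvdpP [q ->] : 'X^((n - d).+1) %| char_poly (P *m X *m P).
  apply: (@dvdp_char_poly_rank _ _ D).
  have DE : (D * (n - #|S|) = D.-1 * (n - #|S|) + (n - #|S|))%N by rewrite -mulSnr prednK.
  have arith a k r : (k <= r + a)%N -> (#|S| + r + (a + (n - #|S|)) < n + d)%N ->
    (k + (n - d).+1 <= n)%N by lia.
  by apply: arith rk _; rewrite -DE.
by rewrite coefMXn ltnSn.
Qed.

Lemma diag_restr_minor_sum n (S : {set 'I_n}) d : (d <= #|S|)%N ->
  diag_restr n (minor_sum S d) = (-1) ^+ d * esymS d S.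
Proof.
move=> dS; rewrite /diag_restr mxeval_minor_sum.
have -> : coord_proj _ S *m diag_mx (\row_i 'X_i) *m coord_proj _ S =
   diag_mx (\row_i ((i \in S)%:R * 'X_i)) :> 'M[{mpoly rat[n]}]_n.
  rewrite !mulmx_diag; congr diag_mx; apply/rowP => i; rewrite !mxE.
  by case: (i \in S); rewrite ?mul0r // !mul1r mulr1.
rewrite char_poly_trig ?diag_mx_is_trig //.
rewrite (bigID (fun i => i \in S)) /= mulrC.
rewrite (eq_bigr (fun=> 'X)) => [|i /negbTE iS]; last by rewrite !mxE eqxx iS mul0r subr0.
rewrite prodr_const.
rewrite (eq_bigr (fun i => 'X - ('X_i)%:P)) => [|i iS]; last by rewrite !mxE eqxx iS mul1r.
have Sn : (#|S| <= n)%N by rewrite -[n in (_ <= n)%N]card_ord max_card.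
have -> : #|[pred i | i \notin S]| = (n - #|S|)%N.
  have -> : #|[pred i | i \notin S]| = #|~: S| by apply: eq_card => i; rewrite !inE.
  by have := cardsC S; rewrite card_ord; lia.
rewrite coefXnM ltnNge leq_sub2l //= esymSE.
have arith m : (d <= m)%N -> (m <= n)%N -> (n - d - (n - m) + d = m)%N by lia.
by apply: coef_prod_XsubC_set; apply: arith.
Qed.

(** * Column antisymmetrisation *)

Lemma mcoeffMX_if (R : nzRingType) n (p : {mpoly R[n]}) (u g : 'X_{1..n}) :
  (p * 'X_[u])@_g = if (u <= g)%MM then p@_(g - u)%MM else 0.
Proof.
case: ifP => [ug|/negbT ug]; first by rewrite -[in LHS](submK ug) addmC mcoeffMX.
apply/memN_msupp_eq0; rewrite (perm_mem (msuppMX _ _)); apply/negP => /mapP[m _ e].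
by case/negP: ug; rewrite e lem_addr.
Qed.

Lemma mesym1_mem n (U : {set 'I_n}) i : mesym1 U i = (i \in U).
Proof. exact: mnmE. Qed.

Lemma prod_mesym1 (R : comNzRingType) n (U : {set 'I_n}) :
  \prod_(i in U) 'X_i = 'X_[mesym1 U] :> {mpoly R[n]}.
Proof.
rewrite mprodXE; suff -> : (\sum_(i in U) U_(i) = mesym1 U)%MM by []; apply/mnmP => i; rewrite mnm_sumE mnmE.
case iU: (i \in U).
  by rewrite (bigD1 i) //= mnm1E eqxx big1 // => l /andP[_ /negbTE li]; rewrite mnm1E li.
by rewrite big1 // => l lU; rewrite mnm1E; case: eqP => // e; rewrite -e lU in iU.
Qed.

(** Positions [i : 'I_n] are grouped into classes by a labelling [cl].  The
    labels below [L] are those of the columns; every other class is a singleton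
    and stands for one occurrence of the symbol infinity. *)
Section Columns.
Variables (n L : nat) (cl : 'I_n -> nat).

Definition column (j : nat) : {set 'I_n} := [set i | cl i == j].

(** The number of earlier positions in the class of [i]. *)
Definition crank (i : 'I_n) : nat := #|[set l : 'I_n | (cl l == cl i) && (l < i)%N]|.

Lemma crank_lt i l : cl i = cl l -> (i < l)%N -> (crank i < crank l)%N.
Proof.
move=> cil il; apply: proper_card; apply/properP; split.
  apply/subsetP => m; rewrite !inE cil => /andP[-> /=] mi.
  exact: ltn_trans mi il.
by exists i; rewrite !inE ?cil ?eqxx ?il //= ltnn.
Qed.

Lemma crank_inj i l : cl i = cl l -> crank i = crank l -> i = l.
Proof.
move=> cil r; case: (ltngtP i l) => [il|li|/val_inj //].
  by have := crank_lt cil il; rewrite r ltnn.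
by have := crank_lt (esym cil) li; rewrite r ltnn.
Qed.

Lemma crank_ltE i l : cl i = cl l -> (crank i < crank l)%N = (i < l)%N.
Proof.
move=> cil; apply/idP/idP; last exact: crank_lt.
apply: contraTT; rewrite -!leqNgt leq_eqVlt => /orP[/eqP/val_inj -> //|li].
exact/ltnW/crank_lt.
Qed.

Lemma crank_bound i : (crank i < #|column (cl i)|)%N.
Proof.
apply: proper_card; apply/properP; split.
  by apply/subsetP => m; rewrite !inE => /andP[].
by exists i; rewrite !inE ?eqxx ?ltnn.
Qed.

(** Ranks in a column take every value below the height of the column. *)
Lemma crank_surj j r : (r < #|column j|)%N -> exists2 i, cl i = j & crank i = r.
Proof.
move=> rj; set s := [seq crank i | i <- enum (column j)].
have us : uniq s.
  rewrite map_inj_in_uniq ?enum_uniq // => i l; rewrite !mem_enum !inE.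
  by move=> /eqP ci /eqP cj; apply: crank_inj; rewrite ci cj.
have sub : {subset s <= iota 0 #|column j|}.
  move=> _ /mapP[i + ->]; rewrite mem_enum inE mem_iota /= => /eqP ci.
  by have := crank_bound i; rewrite ci.
have [|_ sE] := uniq_min_size us sub; first by rewrite size_map size_iota cardE.
have : r \in s by rewrite sE mem_iota.
by case/mapP => i; rewrite mem_enum inE => /eqP ci rE; exists i.
Qed.

(** The permutations preserving every class. *)
Definition col_perm_pred (s : 'S_n) := [forall i, cl (s i) == cl i].

(** Antisymmetrisation under the permutations of the columns. *)
Definition antisym (g : {mpoly rat[n]}) : {mpoly rat[n]} :=
  \sum_(s : 'S_n | col_perm_pred s) (-1) ^+ s *: msym s g.

Lemma col_perm_predM s t : col_perm_pred s -> col_perm_pred t -> col_perm_pred (s * t)%g.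
Proof.
move=> /forallP cs /forallP ct; apply/forallP => i.
by rewrite permM (eqP (ct _)) (eqP (cs _)).
Qed.

Lemma col_perm_tperm i l : cl i = cl l -> col_perm_pred (tperm i l).
Proof. by move=> cil; apply/forallP => m; case: tpermP => // ->; rewrite cil. Qed.

Lemma antisym_is_linear : linear antisym.
Proof.
move=> a f g; rewrite /antisym scaler_sumr -big_split /=; apply: eq_bigr => s _.
by rewrite msymD msymZ scalerDr !scalerA mulrC.
Qed.
HB.instance Definition _ := GRing.isLinear.Build rat {mpoly rat[n]} {mpoly rat[n]} _
  antisym antisym_is_linear.

Lemma mcoeff_antisym g m : (antisym g)@_m =
  \sum_(s : 'S_n | col_perm_pred s) (-1) ^+ s * g@_[multinom m (s i) | i < n].
Proof.
by rewrite /antisym raddf_sum; apply: eq_bigr => s _; rewrite /= mcoeffZ mcoeff_sym.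
Qed.

(** Coefficients of an antisymmetrised polynomial vanish at exponents taking
    the same value twice in a column. *)
Lemma mcoeff_antisym_eq0 g (m : 'X_{1..n}) i l :
  i != l -> cl i = cl l -> m i = m l -> (antisym g)@_m = 0.
Proof.
move=> il cil mil; suff: (antisym g)@_m = - (antisym g)@_m.
  by move=> e; apply/eqP; rewrite -Num.Theory.eqNr -e.
rewrite {1}mcoeff_antisym (reindex_inj (mulIg (tperm i l))) mcoeff_antisym.
rewrite -sumrN; apply: eq_big => s.
  apply/idP/idP => h; last by apply: col_perm_predM => //; apply: col_perm_tperm.
  rewrite -(mulgK (tperm i l) s) tpermV; apply: col_perm_predM => //.
  exact: col_perm_tperm.
move=> _; rewrite odd_permM odd_tperm il signr_addb expr1 mulrN1 mulNr.
congr (- (_ * _@__)); apply/mnmP => k; rewrite !mnmE permM.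
by case: tpermP => // ->.
Qed.

Lemma antisymM_sym g e : (forall s, col_perm_pred s -> msym s e = e) ->
  antisym (g * e) = antisym g * e.
Proof.
move=> he; rewrite /antisym mulr_suml; apply: eq_bigr => s cs.
by rewrite msymM he // -scalerAl.
Qed.

Lemma msym_esym_column s j d : col_perm_pred s ->
  msym s (esymS d (column j)) = esymS d (column j).
Proof.
move=> cs; have sC (i : 'I_n) : (s i \in column j) = (i \in column j).
  by rewrite !inE (eqP (forallP cs i)).
have {2}<- : s @: column j = column j.
  apply/eqP; rewrite eqEcard card_imset ?leqnn ?andbT; last exact: perm_inj.
  by apply/subsetP => _ /imsetP[i iC ->]; rewrite sC.
rewrite !esymSE rmorph_esum esum_imset; last exact: perm_inj.
by apply: eq_bigr => T _; apply: eq_bigr => i _; rewrite /= /msym mmapX mmap1U.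
Qed.

(** The ideal generated by the elementary symmetric polynomials of positive
    degree of each column. *)
Definition column_ideal : ideal {mpoly rat[n]} :=
  ideal_gen (fun g => exists j d, [/\ (j < L)%N, (0 < d)%N & g = esymS d (column j)]).

(** Exponents whose value in each column is the rank. *)
Definition is_stair_exp (g : 'X_{1..n}) := forall i, (cl i < L)%N -> g i = crank i.

(** For a nonempty set [U] of positions of one column, the coefficient at [g] of
    a product with [\prod_(i in U) 'X_i] is the coefficient of the other factor at
    [g] lowered by one on [U], an exponent that takes some value twice in the
    column. *)
Lemma column_ideal_coef g f : is_stair_exp g -> column_ideal f -> (antisym f)@_g = 0.
Proof.
move=> gst [s sG ->]; rewrite (linear_sum antisym) (raddf_sum (mcoeff g)) big_seq big1 //.
move=> [q e] /sG[/= j [d [jL d0 ->]]].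
rewrite antisymM_sym => [|t ct]; last exact: msym_esym_column.
rewrite esymSE /esum mulr_sumr raddf_sum big1 // => U /andP[UC /eqP Ud] /=.
rewrite prod_mesym1 mcoeffMX_if; case: ifP => // ug.
(* The element [i] of [U] of least rank collides with its predecessor, which
   is not in [U]. *)
have [i0 i0U] : exists i, i \in U by apply/set0Pn; rewrite -card_gt0 Ud.
case: (arg_minnP crank i0U) => i /= iU imin; have {}iU : i \in U := iU.
have cE l : l \in U -> cl l = j by move/(subsetP UC); rewrite inE => /eqP.
have gi : g i = crank i by apply: gst; rewrite cE.
have ri : (0 < crank i)%N by rewrite -gi; have /mnm_lepP/(_ i) := ug; rewrite mesym1_mem iU.
have [l cll rl] : exists2 l, cl l = j & crank l = (crank i).-1.
  apply: crank_surj; apply: leq_ltn_trans (leq_pred _) _.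
  by have := crank_bound i; rewrite cE.
have lU : l \notin U by apply/negP => /imin; rewrite rl; case: (crank i) ri => //= r _; rewrite ltnn.
apply: (@mcoeff_antisym_eq0 _ _ i l); first by apply: contraNneq lU => <-.
  by rewrite cE.
rewrite !mnmBE !mesym1_mem iU (negbTE lU) subn0 gi subn1 gst ?rl ?cll //.
Qed.

End Columns.

(** * Independence from triangular functionals *)

(** Lexicographic order on exponents, the last variable being the most
    significant one. *)
Definition ltx n (a b : 'X_{1..n}) : bool :=
  [exists i : 'I_n, (a i < b i)%N && [forall l : 'I_n, (i < l)%N ==> (a l == b l)]].

Lemma ltxP n (a b : 'X_{1..n}) :
  reflect (exists2 i : 'I_n, (a i < b i)%N & forall l : 'I_n, (i < l)%N -> a l = b l)
          (ltx a b).
Proof.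
apply: (iffP existsP) => [[i /andP[ab /forallP h]]|[i ab h]]; exists i => //.
  by move=> l il; have := h l; rewrite il => /eqP.
by rewrite ab; apply/forallP => l; apply/implyP => /h ->.
Qed.

Lemma ltx_trans n : transitive (@ltx n).
Proof.
move=> b a c /ltxP[i abi abl] /ltxP[j bcj bcl]; apply/ltxP.
case: (ltngtP i j) => [ij|ji|/val_inj e].
- exists j; first by rewrite abl.
  by move=> l jl; rewrite abl ?bcl // (ltn_trans ij).
- exists i; first by rewrite -bcl.
  by move=> l il; rewrite abl ?bcl // (ltn_trans ji).
- rewrite -e in bcj bcl; exists i; first exact: ltn_trans abi bcj.
  by move=> l il; rewrite abl ?bcl.
Qed.

Lemma ltxx n (a : 'X_{1..n}) : ltx a a = false.
Proof. by apply/ltxP => -[i]; rewrite ltnn. Qed.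

Lemma ltx_add2r n (a b g : 'X_{1..n}) : ltx (a + g)%MM (b + g)%MM = ltx a b.
Proof.
apply/idP/idP => /ltxP[i ab abl]; apply/ltxP; exists i.
- by move: ab; rewrite !mnmDE ltn_add2r.
- by move=> l /abl; rewrite !mnmDE => /addIn.
- by rewrite !mnmDE ltn_add2r.
- by move=> l /abl; rewrite !mnmDE => ->.
Qed.

Lemma ltx_minimal n (t : seq 'X_{1..n}) : t != [::] ->
  exists2 a, a \in t & forall b, b \in t -> ~~ ltx b a.
Proof.
elim: t => // x t IH _; case: (eqVneq t [::]) => [->|/IH[a at_ amin]].
  by exists x; rewrite ?mem_head // => b; rewrite inE => /eqP ->; rewrite ltxx.
have [xa|xa] := boolP (ltx x a).
  exists x; rewrite ?mem_head // => b; rewrite inE => /predU1P[->|/amin]; first by rewrite ltxx.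
  by apply: contra => bx; apply: ltx_trans bx xa.
by exists a; rewrite ?inE ?at_ ?orbT // => b /predU1P[->|/amin].
Qed.

(** Monomials detected by functionals that vanish on an ideal and are triangular
    for [ltx] are independent modulo this ideal: the functional of the minimal
    monomial of a relation isolates its coefficient. *)
Lemma triangular_independent n (C : 'X_{1..n} -> Prop) (K : ideal {mpoly rat[n]}) :
  (forall a, C a -> exists psi : {scalar {mpoly rat[n]}},
     [/\ forall f, K f -> psi f = 0, psi 'X_[a] != 0
       & forall b, psi 'X_[b] != 0 -> b = a \/ ltx b a]) ->
  forall (s : seq 'X_{1..n}) (c : 'X_{1..n} -> rat),
    uniq s -> (forall m, m \in s -> C m) ->
    K (\sum_(m <- s) c m *: 'X_[m]) -> forall m, m \in s -> c m = 0.
Proof.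
move=> H s c us sC Ks; pose t := [seq m <- s | c m != 0].
have [t0 m ms|tn] := eqVneq t [::].
  by apply/eqP/negPn/negP => cm; have : m \in t; [rewrite mem_filter cm | rewrite t0].
have [a] := ltx_minimal tn; rewrite mem_filter => /andP[ca as_] amin.
have [psi [psiK psia psib]] := H a (sC a as_).
have := psiK _ Ks; rewrite linear_sum (bigD1_seq a) //= linearZ big_seq_cond big1.
  by move/eqP; rewrite addr0 mulf_eq0 (negbTE ca) (negbTE psia).
move=> b /andP[bs ba]; rewrite linearZ; apply/eqP; rewrite mulf_eq0.
have [//|cb] := eqVneq (c b) 0; apply/negPn/negP => /psib[e|]; first by rewrite e eqxx in ba.
by apply/negP/amin; rewrite mem_filter cb.
Qed.

Section StairFunctional.
Variables (n L : nat) (cl : 'I_n -> nat).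
Hypothesis inf_inj : forall i l, cl i = cl l -> (L <= cl i)%N -> i = l.

(** The largest position moved by [s] is moved down, to a smaller rank. *)
Lemma stair_perm_lt g s : is_stair_exp L cl g -> col_perm_pred cl s -> s != 1%g ->
  ltx [multinom g (s i) | i < n] g.
Proof.
move=> gst /forallP cs s1.
have [i0 si0] : exists i, s i != i.
  apply/existsP; apply: contraNT s1 => /existsPn h; apply/eqP/permP => i.
  by rewrite perm1; apply/eqP/negPn/h.
case: (arg_maxnP (fun i : 'I_n => i : nat) (si0 : (fun i => s i != i) i0)) => i /= si imax.
have fix_ (l : 'I_n) : (i < l)%N -> s l = l.
  by move=> il; apply/eqP; apply: contraTT il => /imax; rewrite -leqNgt.
have sil : (s i < i)%N.
  case: (ltngtP (s i) i) => // [|/val_inj/eqP]; last by rewrite (negbTE si).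
  by move/fix_/perm_inj/eqP; rewrite (negbTE si).
have ci : cl (s i) = cl i by apply/eqP.
have iL : (cl i < L)%N.
  by rewrite ltnNge; apply: contra si => Li; apply/eqP/inf_inj; rewrite ?ci.
apply/ltxP; exists i; first by rewrite mnmE !gst ?ci // crank_lt.
by move=> l /fix_ e; rewrite mnmE e.
Qed.

(** The coefficient at [g] after multiplication by ['X_[u]] and column
    antisymmetrisation. *)
Definition stair_functional (u g : 'X_{1..n}) (f : {mpoly rat[n]}) : rat :=
  (antisym cl ('X_[u] * f))@_g.

Lemma stair_functional_is_linear u g : scalar (stair_functional u g).
Proof.
move=> a f f'; rewrite /stair_functional mulrDr -scalerAr linearP.
by rewrite mcoeffD mcoeffZ.
Qed.
HB.instance Definition _ u g := GRing.isLinear.Build rat {mpoly rat[n]} rat _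
  (stair_functional u g) (stair_functional_is_linear u g).

Lemma stair_functionalX u g b :
  stair_functional u g 'X_[b] =
  \sum_(s : 'S_n | col_perm_pred cl s)
     (-1) ^+ s * ((u + b)%MM == [multinom g (s i) | i < n])%:R.
Proof.
by rewrite /stair_functional -mpolyXD mcoeff_antisym; apply: eq_bigr => s _; rewrite mcoeffX.
Qed.

Lemma stair_functional_triangular a g : is_stair_exp L cl g -> (a <= g)%MM ->
  [/\ stair_functional (g - a) g 'X_[a] != 0
    & forall b, stair_functional (g - a) g 'X_[b] != 0 -> b = a \/ ltx b a].
Proof.
move=> gst ag; split=> [|b].
  rewrite stair_functionalX submK // (bigD1 1%g) /=; last first.
    by apply/forallP => i; rewrite perm1.
  rewrite big1 => [|s /andP[cs s1]].
    by rewrite odd_perm1 mul1r addr0 (_ : [multinom _ | _ < _] = g) ?eqxx ?oner_eq0 //;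
       apply/mnmP => i; rewrite mnmE perm1.
  case: eqP => [e|]; last by rewrite mulr0.
  by have := stair_perm_lt gst cs s1; rewrite -e ltxx.
rewrite stair_functionalX => nz.
have [s cs e] : exists2 s, col_perm_pred cl s &
    ((g - a) + b)%MM = [multinom g (s i) | i < n].
  have [/existsP[s /andP[cs /eqP e]]|/existsPn h] := boolP [exists s : 'S_n,
    col_perm_pred cl s && ((g - a + b)%MM == [multinom g (s i) | i < n])]; first by exists s.
  move: nz; rewrite big1 ?eqxx // => s cs.
  by have := h s; rewrite cs /= => /negbTE ->; rewrite mulr0.
have [s1|s1] := eqVneq s 1%g.
  left; apply/mnmP => i; move/mnmP/(_ i): e; rewrite s1 mnmDE mnmBE mnmE perm1.
  by have /mnm_lepP/(_ i) := ag; lia.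
right; have := stair_perm_lt gst cs s1; rewrite -e.
by rewrite -(ltx_add2r b a (g - a)) [(b + _)%MM]addmC [(a + _)%MM]addmC submK.
Qed.

Lemma stair_functional_ideal u g f : is_stair_exp L cl g -> column_ideal L cl f ->
  stair_functional u g f = 0.
Proof. by move=> gst fI; apply: (column_ideal_coef gst); apply: ideal_memM. Qed.
End StairFunctional.

(** * Polynomial identities and congruences *)

Lemma poly_rat_eq0 (q : {poly rat}) : (forall a, a != 0 -> q.[a] = 0) -> q = 0.
Proof.
move=> h; apply: (@roots_geq_poly_eq0 _ _ [seq (i.+1)%:R | i <- iota 0 (size q)]).
- by apply/allP => _ /mapP[i _ ->]; apply/rootP/h; rewrite Num.Theory.pnatr_eq0.
- by rewrite map_inj_uniq ?iota_uniq // => i j /eqP; rewrite Num.Theory.eqr_nat => /eqP[].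
- by rewrite size_map size_iota.
Qed.

(** Induction on the number of variables: [c k] is the coefficient of the [k]-th
    power of the last variable. *)
Lemma mpoly_eval_eq0 n (p : {mpoly rat[n]}) : (forall v, p.@[v] = 0) -> p = 0.
Proof.
elim: n p => [|n IH] p h.
  by have := h (fun=> 0); rewrite -[p]mpolyKC mevalC => ->; rewrite mpolyC0.
pose res (m : 'X_{1..n.+1}) : 'X_{1..n} := [multinom m (widen_ord (leqnSn n) i) | i < n].
have pE v t : p.@[fun i => if unlift ord_max i is Some j then v j else t] =
    \sum_(m <- msupp p) p@_m * (('X_[res m]).@[v] * t ^+ m ord_max).
  rewrite mevalE; apply: eq_bigr => m _; congr (_ * _).
  rewrite mevalX big_ord_recr /= unlift_none; congr (_ * _).
  apply: eq_bigr => i _; rewrite mnmE.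
  have -> : widen_ord (leqnSn n) i = lift ord_max i.
    by apply/val_inj; rewrite /= /bump leqNgt ltn_ord.
  by rewrite liftK.
pose c k : {mpoly rat[n]} := \sum_(m <- msupp p) (p@_m * (m ord_max == k)%:R) *: 'X_[res m].
have c0 k : c k = 0.
  apply: IH => v; pose q : {poly rat} := \sum_(m <- msupp p) (p@_m * ('X_[res m]).@[v]) *: 'X^(m ord_max).
  have q0 : q = 0.
    apply: poly_rat_eq0 => t _; rewrite -[RHS](h (fun i => if unlift ord_max i is Some j then v j else t)).
    rewrite pE /q horner_sum; apply: eq_bigr => m _.
    by rewrite hornerZ hornerXn mulrA.
  have -> : (c k).@[v] = q`_k; last by rewrite q0 coef0.
  rewrite coef_sum (raddf_sum (meval v)); apply: eq_bigr => m _ /=.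
  by rewrite mevalZ coefZ coefXn eq_sym mulrAC.
apply/mpolyP => m; rewrite mcoeff0; have := congr1 (mcoeff (res m)) (c0 (m ord_max)).
rewrite raddf_sum mcoeff0 /=.
have [ms|/memN_msupp_eq0 -> //] := boolP (m \in msupp p).
rewrite (bigD1_seq m) ?msupp_uniq //= mcoeffZ mcoeffX !eqxx !mulr1 big1 ?addr0 // => m' m'm.
rewrite mcoeffZ mcoeffX; have [e1|] := eqVneq (m' ord_max) (m ord_max); last by rewrite mulr0 mul0r.
have [e2|] := eqVneq (res m') (res m); last by rewrite mulr0.
case/eqP: m'm; apply/mnmP => i; case: (unliftP ord_max i) => [j|] -> //.
have -> : lift ord_max j = widen_ord (leqnSn n) j.
  by apply/val_inj; rewrite /= /bump leqNgt ltn_ord.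
by move/mnmP/(_ j): e2; rewrite !mnmE.
Qed.

Section IdealCongruence.
Variables (A : comPzRingType) (I : ideal A).

Lemma ideal_memN x : I x -> I (- x).
Proof. by rewrite -mulN1r; apply: ideal_memM. Qed.

Lemma ideal_memB x y : I x -> I y -> I (x - y).
Proof. by move=> Ix Iy; apply: ideal_memD => //; apply: ideal_memN. Qed.

Lemma ideal_mem_sum (J : Type) (r : seq J) (P : pred J) (F : J -> A) :
  (forall j, P j -> I (F j)) -> I (\sum_(j <- r | P j) F j).
Proof.
move=> h; elim/big_ind: _ => //; [exact: ideal_mem0|exact: ideal_memD].
Qed.

Lemma ideal_congrM x x' y y' : I (x - x') -> I (y - y') -> I (x * y - x' * y').
Proof.
move=> Ix Iy; have -> : x * y - x' * y' = x * (y - y') + y' * (x - x') by ring.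
by apply: ideal_memD; apply: ideal_memM.
Qed.

Lemma ideal_congr_prod (J : Type) (r : seq J) (F G : J -> A) :
  (forall j, I (F j - G j)) -> I (\prod_(j <- r) F j - \prod_(j <- r) G j).
Proof.
move=> h; elim/big_ind2: _ => //; first by rewrite subrr; apply: ideal_mem0.
by move=> x1 x2 y1 y2; apply: ideal_congrM.
Qed.

Lemma ideal_congrX x y k : I (x - y) -> I (x ^+ k - y ^+ k).
Proof.
move=> h; elim: k => [|k IH]; first by rewrite !expr0 subrr; apply: ideal_mem0.
by rewrite !exprS; apply: ideal_congrM.
Qed.

End IdealCongruence.

Lemma ideal_congr_mxeval (A : comNzRingType) (I : ideal A) n (io : {rmorphism rat -> A}) (M M' : 'M[A]_n) f :
  (forall i j, I (M i j - M' i j)) -> I (mxeval io M f - mxeval io M' f).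
Proof.
move=> h; rewrite !mxevalE -sumrB; apply: ideal_mem_sum => m _.
rewrite -mulrBr; apply/ideal_memM/ideal_congr_prod => e; apply: ideal_congrX.
by case/mxvec_indexP: e => i j; rewrite !mxvecE.
Qed.

(** * Matrices of the rank variety with prescribed diagonal *)

Section Deformation.
Variables (n L : nat) (cl : 'I_n -> nat).
Hypothesis inf_inj : forall i l, cl i = cl l -> (L <= cl i)%N -> i = l.

Local Notation P := {mpoly rat[n]}.
Local Notation col i := (column cl (cl i)).
Local Notation rk := (crank cl).
Local Notation CI := (column_ideal L cl).

(** [l] follows [i] in its column. *)
Definition col_succ (i l : 'I_n) : bool := (cl l == cl i) && (rk l == (rk i).+1).

Lemma col_succ_lt i l : col_succ i l -> (i < l)%N.
Proof. by case/andP => /eqP cil /eqP r; rewrite -(crank_ltE (esym cil)) r. Qed.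

Lemma col_succ_fin i l : col_succ i l -> (cl i < L)%N.
Proof.
move=> s; rewrite ltnNge; apply/negP => Li; have := col_succ_lt s.
case/andP: s => /eqP e _; by rewrite (inf_inj (esym e) Li) ltnn.
Qed.

(** Zero on the diagonal at the positions of the columns, [v] at the others, and
    ones at the pairs of consecutive positions of a column. *)
Definition free_nilp_mx (A : nzRingType) (v : 'I_n -> A) : 'M[A]_n :=
  \matrix_(i, l) (if i == l then if (cl i < L)%N then 0 else v i else (col_succ i l)%:R).

Definition below (i : 'I_n) : {set 'I_n} := [set l | (cl l == cl i) && (l < i)%N].

(** The Newton polynomial at [i], with the variables of the earlier positions of
    the column of [i] as roots. *)
Definition newton (i : 'I_n) : {poly P} := \prod_(l in below i) ('X - ('X_l)%:P).

Lemma newton_size i : size (newton i) = (rk i).+1.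
Proof. by rewrite /newton -big_enum size_prod_XsubC -cardE. Qed.

Lemma newton_monic i : newton i \is monic.
Proof. exact: monic_prod_XsubC. Qed.

Lemma newton_step i : newton i * ('X - ('X_i)%:P) =
  \prod_(l in i |: below i) ('X - ('X_l)%:P).
Proof. by rewrite big_setU1 1?mulrC //= inE ltnn andbF. Qed.

Lemma newton_succ i l : col_succ i l -> newton l = newton i * ('X - ('X_i)%:P).
Proof.
move=> s; have il := col_succ_lt s; case/andP: s => /eqP e /eqP r.
rewrite newton_step; apply: eq_bigl; apply/subset_eqP; apply/andP.
suff /eqP -> : i |: below i == below l by split; apply/subsetP.
rewrite eqEcard; apply/andP; split; last first.
  rewrite cardsU1 inE ltnn andbF /= add1n -/(rk i) -r; exact: leqnn.
apply/subsetP => m; rewrite !inE e => /predU1P[->|/andP[-> mi]]; first by rewrite eqxx.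
exact: ltn_trans mi il.
Qed.

Lemma newton_last i : (forall l, ~~ col_succ i l) ->
  newton i * ('X - ('X_i)%:P) = \prod_(l in col i) ('X - ('X_l)%:P).
Proof.
move=> h; rewrite newton_step; apply: eq_bigl; apply/subset_eqP; apply/andP.
suff /eqP -> : i |: below i == col i by split; apply/subsetP.
rewrite eqEcard; apply/andP; split.
  apply/subsetP => m; rewrite !inE => /predU1P[->|/andP[-> //]]; exact: eqxx.
rewrite cardsU1 inE ltnn andbF /= add1n -/(rk i) leqNgt; apply/negP => lt.
by have [l cll rl] := crank_surj lt; have := h l; rewrite /col_succ cll rl !eqxx.
Qed.

(** The rows are the coordinates of the Newton polynomials in the monomial basis
    of their column: the position of rank [r] stands for the [r]-th power. *)
Definition newton_mx : 'M[P]_n :=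
  \matrix_(i, l) (if cl l == cl i then (newton i)`_(rk l) else 0).

Lemma det_newton_mx : \det newton_mx = 1.
Proof.
rewrite det_trig.
  rewrite big1 // => i _; rewrite mxE eqxx.
  by have := newton_monic i; rewrite monicE lead_coefE newton_size => /eqP.
apply/is_trig_mxP => i l il; rewrite mxE; case: eqP => // e.
by rewrite nth_default // newton_size crank_lt.
Qed.

(** The matrix with diagonal [v] and the entries [w ^+ (l - i)] at the
    positions where [l] follows [i]. *)
Definition bidiag_mx (A : nzRingType) (v : 'I_n -> A) (w : A) : 'M[A]_n :=
  \matrix_(i, l) (if i == l then v i else if col_succ i l then w ^+ (l - i) else 0).

(** [newton_mx] conjugates the nilpotent-plus-free matrix to the bidiagonal one
    modulo the column ideal: on a column, both sides express multiplication by ['X], and they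
    differ only at the last position of a column, by a coefficient of the product
    of the [X - x_l] over the whole column. *)
Lemma newton_mx_conj i l :
  CI ((newton_mx *m free_nilp_mx (fun i => 'X_i)) i l
      - (bidiag_mx (fun i => 'X_i) 1 *m newton_mx) i l).
Proof.
have CI0 := ideal_mem0 CI; set N := free_nilp_mx _.
have XB : (bidiag_mx (fun i => 'X_i) 1 *m newton_mx) i l =
    'X_i * newton_mx i l + \sum_(m | col_succ i m) newton_mx m l.
  rewrite mxE (bigD1 i) //= mxE eqxx; congr (_ + _); rewrite big_mkcond [RHS]big_mkcond /=.
  apply: eq_bigr => m _; rewrite [in LHS]mxE expr1n eq_sym; case: eqP => [->|_] /=.
    by case: ifP => // /col_succ_lt; rewrite ltnn.
  by case: ifP; rewrite ?mul1r ?mul0r.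
rewrite XB; have [e|ne] := eqVneq (cl l) (cl i); last first.
  rewrite [newton_mx i l]mxE (negbTE ne) mulr0 add0r big1 => [|m /andP[/eqP cm _]]; last first.
    by rewrite mxE cm (negbTE ne).
  rewrite subr0 mxE big1; first exact: CI0.
  move=> m _; rewrite !mxE; case: eqP => [cm|]; last by rewrite mul0r.
  have lm : m != l by apply: contraNneq ne => <-; rewrite cm.
  by rewrite (negbTE lm) /col_succ cm (negbTE ne) mulr0.
have [Li|iL] := leqP L (cl i).
  have il := inf_inj (esym e) Li; rewrite -{}il in e *.
  rewrite big1 => [|m /col_succ_fin]; last by rewrite ltnNge Li.
  rewrite addr0 !mxE eqxx (bigD1 i) //= big1.
    rewrite !mxE !eqxx ltnNge Li /= addr0 mulrC subrr; exact: CI0.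
  move=> m mi; rewrite !mxE; case: eqP => [cm|]; last by rewrite mul0r.
  by case/eqP: mi; apply: inf_inj; rewrite ?cm.
have BN : (newton_mx *m N) i l = ('X * newton i)`_(rk l).
  rewrite coefXM mxE; case: eqP => r0.
    rewrite big1 // => m _; rewrite !mxE; case: eqP => cm; rewrite ?mul0r //.
    case: eqP => [_|_]; first by rewrite cm iL mulr0.
    by rewrite /col_succ r0 /= andbF mulr0.
  have [m cm rm] : exists2 m, cl m = cl i & rk m = (rk l).-1.
    by apply: crank_surj; rewrite -e; apply: leq_ltn_trans (leq_pred _) (crank_bound _ _).
  have rl : rk l = (rk m).+1 by rewrite rm; case: (rk l) r0.
  have sml : col_succ m l by rewrite /col_succ e cm rl !eqxx.
  have ml : m != l by have := col_succ_lt sml; rewrite ltn_neqAle => /andP[].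
  rewrite (bigD1 m) //= !mxE cm eqxx (negbTE ml) sml mulr1 rm big1 ?addr0 // => m' m'm.
  rewrite !mxE; case: eqP => cm'; rewrite ?mul0r //.
  case: eqP => [_|_]; first by rewrite cm' iL mulr0.
  case s': (col_succ m' l); rewrite ?mulr0 //.
  case/andP: s' => _ /eqP; rewrite rl => -[] r'.
  by case/eqP: m'm; apply: crank_inj (esym r'); rewrite cm'.
have qE : ('X * newton i)`_(rk l) - 'X_i * newton_mx i l =
    (newton i * ('X - ('X_i)%:P))`_(rk l).
  by rewrite mxE e eqxx mulrBr coefB mulrC coefMC [_ * 'X_i]mulrC.
rewrite BN opprD addrA qE.
have [/existsP[m sim]|/existsPn no] := boolP [exists m, col_succ i m].
  rewrite (bigD1 m) //= big1 => [|m' /andP[s' m'm]].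
    rewrite mxE (_ : cl m = cl i) ?e ?eqxx ?(newton_succ sim) ?addr0 ?subrr; last by case/andP: sim => /eqP.
    exact: CI0.
  case/andP: s' => /eqP cm' /eqP rm'; case/andP: sim => /eqP cm /eqP rm.
  by case/eqP: m'm; apply: (@crank_inj _ cl); rewrite ?cm' ?cm ?rm' ?rm.
rewrite big_pred0 => [|m]; last exact/negbTE.
rewrite subr0 newton_last // (@coef_prod_XsubC_set _ _ _ _ (#|col i| - rk l)%N); last first.
  by rewrite subnKC // ltnW // -e crank_bound.
apply: ideal_memM; exists [:: (1, esymS (#|col i| - rk l) (col i))]; last by rewrite big_seq1 mul1r.
move=> _ /[!inE] /eqP -> /=; exists (cl i), (#|col i| - rk l)%N; split=> //.
by rewrite subn_gt0 -e crank_bound.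
Qed.
End Deformation.

Lemma expr_conj (R : pzRingType) (x y z : R) d : z * x = 1 ->
  (x * y * z) ^+ d.+1 = x * y ^+ d.+1 * z.
Proof.
move=> zx; elim: d => [|d IH]; first by rewrite !expr1.
by rewrite exprSr IH [y ^+ d.+2]exprSr !mulrA -[_ * z * x]mulrA zx mulr1.
Qed.

Lemma mulmx_subE (R : pzRingType) m n p (A B : 'M[R]_(m, n)) (C : 'M[R]_(n, p)) i l :
  (A *m C) i l - (B *m C) i l = \sum_j (A i j - B i j) * C j l.
Proof. by rewrite !mxE -sumrB; apply: eq_bigr => j _; rewrite mulrBl. Qed.

Section Vanishing.
Variables (n L : nat) (cl : 'I_n -> nat).
Hypothesis inf_inj : forall i l, cl i = cl l -> (L <= cl i)%N -> i = l.

Local Notation P := {mpoly rat[n]}.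
Local Notation CI := (column_ideal L cl).

(** Row [i] of the nilpotent part moves [d] steps down its column. *)
Lemma free_nilp_row_eq0 (F : fieldType) (v : 'I_n -> F) d i :
  (cl i < L)%N -> (#|column cl (cl i)| <= crank cl i + d)%N ->
  row i (free_nilp_mx L cl v ^+ d) = 0.
Proof.
elim: d i => [|d IH] i iL le.
  by have := crank_bound cl i; rewrite ltnNge -[X in (_ <= X)%N]addn0 le.
apply/rowP => m; rewrite !mxE exprS -mulmxE mxE big1 // => l _.
rewrite mxE; case: eqP => [_|_]; first by rewrite iL mul0r.
case s: (col_succ cl i l); rewrite ?mul0r // mul1r.
case/andP: s => /eqP e /eqP r.
by have /rowP/(_ m) : row l (free_nilp_mx L cl v ^+ d) = 0; [apply: IH; rewrite e // r addSnnS|rewrite !mxE].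
Qed.

Lemma card_by_label (T : {set 'I_n}) :
  (\sum_(j < L) #|[set i in T | cl i == j]| = #|[set i in T | (cl i < L)%N]|)%N.
Proof.
have cE (Q : pred 'I_n) : #|[set i in T | Q i]| = (\sum_(i in T) Q i)%N.
  by rewrite -sum1dep_card -big_mkcondr.
rewrite cE; transitivity (\sum_(j < L) \sum_(i in T) (cl i == j))%N.
  by apply: eq_bigr => j _; apply: cE.
rewrite exchange_big /=.
apply: eq_bigr => i _; case: ltnP => iL.
  by rewrite (bigD1 (Ordinal iL)) //= eqxx big1 // => j; rewrite -val_eqE /= eq_sym => /negbTE ->.
by rewrite big1 // => j _; case: eqP => // e; rewrite e leqNgt ltn_ord in iL.
Qed.

(** The rows of the last [d] positions of each column are zero in the power. *)
Lemma rank_free_nilp (F : fieldType) (v : 'I_n -> F) d :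
  (\rank (free_nilp_mx L cl v ^+ d)%R + \sum_(j < L) minn d #|column cl j| <= n)%N.
Proof.
(* [Z] collects the rows that vanish in the [d]-th power. *)
pose Z : {set 'I_n} := [set i | (cl i < L)%N && (#|column cl (cl i)| <= crank cl i + d)%N].
have rk : (\rank (free_nilp_mx L cl v ^+ d)%R <= #|~: Z|)%N.
  apply: rank_leq_card_rows => i; rewrite !inE negbK => /andP[iL]; exact: free_nilp_row_eq0.
suff : (\sum_(j < L) minn d #|column cl j| <= #|Z|)%N.
  by have := cardsC Z; rewrite card_ord; lia.
have -> : #|Z| = #|[set i in Z | (cl i < L)%N]|.
  by apply: eq_card => i; rewrite !inE; case: (cl i < L)%N; rewrite ?andbF ?andbT.
rewrite -card_by_label; apply: leq_sum => j _.
set h := #|column cl j|.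
pose s := [seq crank cl i | i <- enum [set i in Z | cl i == j]].
have sub : {subset iota (h - d) (minn d h) <= s}.
  move=> r; rewrite mem_iota => /andP[r1 r2].
  have rh : (r < #|column cl j|)%N by rewrite -/h; lia.
  have [i ci ri] := crank_surj rh; apply/mapP; exists i => //.
  by rewrite mem_enum !inE ci eqxx ltn_ord -/h ri /=; lia.
have := uniq_leq_size (iota_uniq _ _) sub.
by rewrite size_iota size_map -cardE.
Qed.

Lemma bidiag_mx_conj (a : rat) (i l : 'I_n) : a != 0 ->
  bidiag_mx cl (fun i => 'X_i) a%:MP i l =
  (a^-1 ^+ i)%:MP * bidiag_mx cl (fun i => 'X_i) 1 i l * (a ^+ l)%:MP :> P.
Proof.
move=> a0; rewrite !mxE; case: eqP => [->|_].
  by rewrite mulrC mulrA -mpolyCM -exprMn divff // expr1n mpolyC1 mul1r.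
case: ifP => [s|]; last by rewrite mulr0 mul0r.
rewrite expr1n mulr1 -mpolyCM -(subnK (ltnW (col_succ_lt s))) exprD addnK.
by rewrite mulrCA -exprMn mulVf // expr1n mulr1 rmorphXn.
Qed.

(** The diagonal matrix of the powers of [a]. *)
Definition pow_diag_mx (a : rat) : 'M[P]_n := diag_mx (\row_i (a ^+ i)%:MP).

(** The conjugate of the nilpotent-plus-free matrix by [newton_mx]. *)
Definition free_conj_mx : 'M[P]_n :=
  newton_mx cl *m free_nilp_mx L cl (fun i => 'X_i) *m \adj (newton_mx cl).

(** The matrix [D^-1 * (B * N * B^-1) * D], where [B] is the matrix of Newton
    polynomials, [N] the nilpotent-plus-free matrix and [D] the diagonal matrix
    of the powers of [a].  For [a != 0], all its rational specialisations are
    conjugate to specialisations of [N]. *)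
Definition deform_mx (a : rat) : 'M[P]_n :=
  pow_diag_mx a^-1 *m free_conj_mx *m pow_diag_mx a.

Lemma deform_mxE a i l :
  deform_mx a i l = (a^-1 ^+ i)%:MP * free_conj_mx i l * (a ^+ l)%:MP.
Proof.
rewrite /deform_mx /pow_diag_mx mul_mx_diag mul_diag_mx; move: free_conj_mx => C.
by rewrite !mxE.
Qed.

Lemma pow_diag_mxV a : a != 0 -> pow_diag_mx a *m pow_diag_mx a^-1 = 1%:M.
Proof.
move=> a0; rewrite mulmx_diag -diag_const_mx; congr diag_mx; apply/rowP => i; rewrite !mxE.
by rewrite -mpolyCM -exprMn divff // expr1n.
Qed.

Lemma newton_mx_adj : newton_mx cl *m \adj (newton_mx cl) = 1%:M.
Proof. by rewrite mul_mx_adj det_newton_mx. Qed.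

Lemma bidiag_mx_congr (a : rat) i l : a != 0 ->
  CI (bidiag_mx cl (fun i => 'X_i) a%:MP i l - deform_mx a i l).
Proof.
move=> a0; rewrite bidiag_mx_conj //; pose X1 : 'M[P]_n := bidiag_mx cl (fun i => 'X_i) 1.
pose B := newton_mx cl; pose N : 'M[P]_n := free_nilp_mx L cl (fun i => 'X_i).
rewrite -/X1.
have -> : X1 i l = ((X1 *m B) *m \adj B) i l.
  by rewrite -mulmxA newton_mx_adj mulmx1.
rewrite deform_mxE.
rewrite -mulrBl -mulrBr mulrC; do 2!apply: ideal_memM.
rewrite /free_conj_mx -/B -/N mulmx_subE; apply: ideal_mem_sum => m _.
rewrite mulrC -opprB mulrN -mulNr; apply: ideal_memM.
exact: newton_mx_conj.
Qed.

Lemma rank_deform_mx (a : rat) (v : 'I_n -> rat) d : a != 0 ->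
  (\rank (map_mx (meval v) (deform_mx a) ^+ d)%R
     + \sum_(j < L) minn d #|column cl j| <= n)%N.
Proof.
move=> a0; set ev := map_mx (meval v).
pose Q := ev (pow_diag_mx a^-1 *m newton_mx cl).
pose Q' := ev (\adj (newton_mx cl) *m pow_diag_mx a).
pose N := free_nilp_mx L cl v.
have eN : ev (free_nilp_mx L cl (fun i => 'X_i)) = N.
  apply/matrixP => i l; rewrite !mxE; case: eqP => _; last by rewrite rmorph_nat.
  by case: ifP => _; rewrite ?raddf0 // mevalXU.
have eD : ev (deform_mx a) = Q * N * Q'.
  rewrite -eN -!mulmxE /Q /Q' /ev -!map_mxM /deform_mx /free_conj_mx.
  by move: (newton_mx cl) (pow_diag_mx _) (pow_diag_mx _) => B D D'; rewrite !mulmxA.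
have QQ : Q' * Q = 1.
  rewrite /Q /Q' -mulmxE -map_mxM mulmxA -[_ *m pow_diag_mx _ *m pow_diag_mx _]mulmxA.
  by rewrite pow_diag_mxV // mulmx1 mul_adj_mx det_newton_mx map_mx1.
case: d => [|d]; first by have := rank_free_nilp v 0; rewrite !expr0.
apply: leq_trans (rank_free_nilp v d.+1); rewrite leq_add2r eD expr_conj //.
by apply: leq_trans (mxrankM_maxl _ _) _; apply: mxrankM_maxr.
Qed.

(** A polynomial vanishing on all matrices whose powers have the ranks allowed
    by the column heights restricts to the diagonal into the kernel of every
    functional that vanishes on the column ideal. *)
Lemma diag_restr_functional f (psi : {scalar P}) :
  (forall X : 'M[rat]_n, (forall d, \rank (X ^+ d)%R
      + \sum_(j < L) minn d #|column cl j| <= n)%N -> gleval X f = 0) ->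
  (forall g, CI g -> psi g = 0) -> psi (diag_restr n f) = 0.
Proof.
move=> f0 psi0.
pose io : {rmorphism rat -> P} := @mpolyC n rat.
have def0 a : a != 0 -> mxeval io (deform_mx a) f = 0.
  move=> a0; apply: mpoly_eval_eq0 => v.
  rewrite (@rmorph_mxeval _ _ _ io idfun (meval v)); last by move=> c; rewrite /= mevalC.
  by rewrite -glevalE; apply: f0 => d; apply: rank_deform_mx.
have bid0 a : a != 0 -> psi (mxeval io (bidiag_mx cl (fun i => 'X_i) a%:MP) f) = 0.
  move=> a0; apply: psi0; rewrite -[mxeval _ _ _]subr0 -(def0 a a0).
  by apply: ideal_congr_mxeval => i l; apply: bidiag_mx_congr.
pose io2 : {rmorphism rat -> {poly P}} := @polyC P \o io.
pose Fp := mxeval io2 (bidiag_mx cl (fun i => ('X_i)%:P) 'X) f.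
have FpE a : Fp.[a%:MP] = mxeval io (bidiag_mx cl (fun i => 'X_i) a%:MP) f.
  rewrite -[LHS]/(horner_eval a%:MP Fp).
  rewrite (@rmorph_mxeval _ _ _ io2 io (horner_eval a%:MP)); last first.
    by move=> c; rewrite /= /horner_eval hornerC.
  rewrite (_ : map_mx _ _ = bidiag_mx cl (fun i => 'X_i) a%:MP) //.
  apply/matrixP => i l; rewrite !mxE; case: eqP => _ /=.
    by rewrite /horner_eval hornerC.
  by case: ifP => _; rewrite /horner_eval ?horner0 // hornerXn.
(* The value of [psi] is a polynomial in [a] that vanishes for all [a != 0],
   hence also at [a = 0], where the matrix is diagonal. *)
pose q : {poly rat} := \poly_(k < size Fp) psi Fp`_k.
have qE a : q.[a] = psi Fp.[a%:MP].
  rewrite horner_poly horner_coef linear_sum; apply: eq_bigr => k _.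
  by rewrite -rmorphXn [Fp`_k * _]mulrC mul_mpolyC linearZ mulrC.
have q0 : q = 0 by apply: poly_rat_eq0 => a a0; rewrite qE FpE bid0.
rewrite /diag_restr (_ : diag_mx _ = bidiag_mx cl (fun i => 'X_i) 0%:MP).
  by rewrite -/io -FpE -qE q0 horner0.
apply/matrixP => i l; rewrite !mxE; case: eqP => [->|_]; first by rewrite mulr1n.
case: ifP => [s|_]; last by rewrite mulr0n.
by rewrite mpolyC0 expr0n subn_eq0 leqNgt (col_succ_lt s).
Qed.
End Vanishing.

(** * Spanning *)

(** Generators of the ideal attached to the column heights [h]. *)
Definition hgens (n : nat) (h : nat -> nat) (g : {mpoly rat[n]}) : Prop :=
  exists (S : {set 'I_n}) (d : nat),
    [/\ (1 <= d)%N, (#|S| < d + \sum_(n - #|S| <= j < n) h j)%N & g = esymS d S].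

Definition hideal n h : ideal {mpoly rat[n]} := ideal_gen (@hgens n h).

Lemma ideal_gen_sub (A : comPzRingType) (G : A -> Prop) (I : ideal A) :
  (forall g, G g -> I g) -> forall f, ideal_gen G f -> I f.
Proof.
move=> GI f [s sG ->]; rewrite big_seq; apply: ideal_mem_sum => cg /sG /GI.
exact: ideal_memM.
Qed.

Lemma mem_ideal_gen (A : comPzRingType) (G : A -> Prop) g : G g -> ideal_gen G g.
Proof.
move=> Gg; exists [:: (1, g)]; last by rewrite big_seq1 mul1r.
by move=> cg; rewrite inE => /eqP ->.
Qed.

(** Label sequences of staircases: the entries below [L] name a column, [L]
    stands for infinity. *)
Definition stair_labels (n L : nat) (h : nat -> nat) (c : seq nat) : Prop :=
  [/\ size c = n, all (fun j => j <= L)%N c & forall j, (j < L)%N -> count_mem j c = h j].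

(** The exponents lie below the word spelled by the labels: a position with the
    label of a column is bounded by the number of earlier occurrences of it. *)
Definition below_stair n L (c : seq nat) (a : 'X_{1..n}) : Prop :=
  forall i : 'I_n, (nth 0 c i < L)%N -> (a i <= count_mem (nth 0%N c i) (take i c))%N.

Definition stair_set n L h (a : 'X_{1..n}) : Prop :=
  exists2 c, stair_labels n L h c & below_stair L c a.

Section SpanMod.
Variables (n : nat) (C : 'X_{1..n} -> Prop) (J : ideal {mpoly rat[n]}).

(** [f] is congruent modulo [J] to a combination of the monomials in [C]. *)
Definition span_mod (f : {mpoly rat[n]}) : Prop :=
  exists2 g, (forall m, m \in msupp g -> C m) & J (f - g).

Lemma span_mod_ideal f : J f -> span_mod f.
Proof. by exists 0; rewrite ?msupp0 ?subr0. Qed.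

Lemma span_modD f f' : span_mod f -> span_mod f' -> span_mod (f + f').
Proof.
move=> [g gC Jg] [g' gC' Jg']; exists (g + g'); last first.
  by rewrite opprD addrACA; apply: ideal_memD.
by move=> m /msuppD_le; rewrite mem_cat => /orP[/gC|/gC'].
Qed.

Lemma span_modZ a f : span_mod f -> span_mod (a *: f).
Proof.
move=> [g gC Jg]; exists (a *: g); first by move=> m /msuppZ_le /gC.
by rewrite -scalerBr -mul_mpolyC; apply: ideal_memM.
Qed.

Lemma span_modX m : C m -> span_mod 'X_[m].
Proof.
move=> Cm; exists 'X_[m]; last by rewrite subrr; apply: ideal_mem0.
by move=> m'; rewrite msuppX inE => /eqP ->.
Qed.

Lemma span_mod_sum (I : Type) (r : seq I) (P : pred I) (F : I -> {mpoly rat[n]}) :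
  (forall i, P i -> span_mod (F i)) -> span_mod (\sum_(i <- r | P i) F i).
Proof.
move=> h; elim/big_ind: _ => //; last exact: span_modD.
by apply: span_mod_ideal; apply: ideal_mem0.
Qed.

Lemma span_mod_linear (phi : {mpoly rat[n]} -> {mpoly rat[n]}) f : linear phi ->
  (forall m, span_mod (phi 'X_[m])) -> span_mod (phi f).
Proof.
move=> lin h.
have phi0 : phi 0 = 0.
  by have := lin (-1) 0 0; rewrite scaler0 addr0 scaleN1r addNr.
elim/mpolyind: f => [|c m p _ _ IH].
  by rewrite phi0; apply: span_mod_ideal; apply: ideal_mem0.
by rewrite lin; apply: span_modD => //; apply: span_modZ.
Qed.
End SpanMod.

Section WidenStep.
Variable n : nat.
Local Notation X := ('X_(ord_max : 'I_n.+1) : {mpoly rat[n.+1]}).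
Local Notation wd := (widen_ord (leqnSn n)).

(** The exponent [m] extended by [i] for the last variable. *)
Definition mnm_ext (m : 'X_{1..n}) (i : nat) : 'X_{1..n.+1} :=
  (mnmwiden m + U_(ord_max) *+ i)%MM.

Lemma mpolyX_ext m i : 'X_[mnm_ext m i] = X ^+ i * mwiden 'X_[m].
Proof. by rewrite mpolyXD mwidenX mulrC mpolyXn. Qed.

Lemma mnm_ext_widen m i (j : 'I_n) : mnm_ext m i (wd j) = m j.
Proof.
rewrite mnmDE mnmwiden_widen mulmnE mnm1E [_ == _]negbTE ?mul0n ?addn0 //.
by rewrite -val_eqE /= neq_ltn ltn_ord orbT.
Qed.

Lemma mnm_ext_max m i : mnm_ext m i ord_max = i.
Proof. by rewrite mnmDE mnmwiden_ordmax mulmnE mnm1E eqxx mul1n. Qed.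

Lemma ord_maxVwiden (i : 'I_n.+1) : i = ord_max \/ exists j, i = wd j.
Proof.
case: (unliftP ord_max i) => [j ->|->]; [right; exists j|by left].
by apply/val_inj; rewrite /= /bump leqNgt ltn_ord.
Qed.

Lemma mnm_extP (b : 'X_{1..n.+1}) : exists m, b = mnm_ext m (b ord_max).
Proof.
exists [multinom b (wd i) | i < n]; apply/mnmP => i.
by case: (ord_maxVwiden i) => [->|[j ->]]; rewrite ?mnm_ext_max ?mnm_ext_widen ?mnmE.
Qed.

Lemma mwiden_esymS (S : {set 'I_n}) d :
  mwiden (esymS d S) = esymS d (wd @: S).
Proof.
have injw : injective wd by move=> i j /(congr1 val) /= /val_inj.
rewrite !esymSE rmorph_esum esum_imset //.
by apply: eq_bigr => T _; apply: eq_bigr => i _; rewrite /= mwidenX mnmwiden1.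
Qed.

Lemma ord_max_widen (S : {set 'I_n}) : ord_max \notin wd @: S.
Proof.
apply/negP => /imsetP[j _ /(congr1 val)] /= e.
by have := ltn_ord j; rewrite -e ltnn.
Qed.

Lemma esymS_max (S : {set 'I_n}) d :
  esymS d.+1 (ord_max |: wd @: S) = esymS d.+1 (wd @: S) + X * esymS d (wd @: S).
Proof. by rewrite !esymSE esumU1 // ord_max_widen. Qed.

Lemma widen_decomp (f : {mpoly rat[n.+1]}) : exists f0 f1, f = mwiden f0 + X * f1.
Proof.
elim/mpolyind: f => [|c m p _ _ [f0 [f1 ->]]]; first by exists 0, 0; rewrite mulr0 addr0 raddf0.
have [m' ->] := mnm_extP m; case: (m ord_max) => [|i].
  exists (c *: 'X_[m'] + f0), f1; rewrite raddfD /= mwidenZ mpolyX_ext expr0 mul1r addrA //.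
exists f0, (c *: 'X_[mnm_ext m' i] + f1); rewrite !mpolyX_ext exprS.
by rewrite mulrDr -scalerAr addrCA mulrA.
Qed.

Section Telescope.
Variable J : ideal {mpoly rat[n.+1]}.

(** Iterating [x * e_d(S) = e_{d+1}(S + x) - e_{d+1}(S)] for the last variable
    [x]. *)
Lemma telescope_mem (S : {set 'I_n}) i d :
  (forall r, (0 < r <= i)%N -> J (esymS (d + r) (ord_max |: wd @: S))) ->
  J (esymS (d + i) (wd @: S)) -> J (X ^+ i * esymS d (wd @: S)).
Proof.
elim: i d => [|i IH] d hT hS; first by rewrite expr0 mul1r -[d]addn0.
have -> : X ^+ i.+1 * esymS d (wd @: S) =
   X ^+ i * esymS d.+1 (ord_max |: wd @: S) - X ^+ i * esymS d.+1 (wd @: S).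
  by rewrite esymS_max exprSr; ring.
apply: ideal_memB; first by apply: ideal_memM; rewrite -[d.+1]addn1; apply: hT.
apply: IH; last by rewrite addSnnS.
by move=> r /andP[r0 ri]; rewrite addSnnS; apply: hT.
Qed.
End Telescope.
End WidenStep.

(** Column heights occurring for [n] positions: weakly decreasing, supported on
    the indices below [n] and below [L], of total at most [n]. *)
Definition heights (n L : nat) (h : nat -> nat) : Prop :=
  [/\ forall i j, (i <= j)%N -> (h j <= h i)%N, forall j, (L <= j)%N -> h j = 0%N,
      forall j, (n <= j)%N -> h j = 0%N & (\sum_(0 <= j < n) h j <= n)%N].

(** A positive entry at the last admissible index leaves room only for ones. *)
Lemma heights_last n L h : heights n.+1 L h -> (0 < h n)%N -> forall j, (j <= n)%N -> h j = 1%N.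
Proof.
move=> [hm _ _ hs] hn.
have pos j : (j <= n)%N -> (0 < h j)%N by move=> jn; apply: leq_trans hn (hm _ _ jn).
suff h0 : (h 0%N <= 1)%N.
  by move=> j jn; apply/eqP; rewrite eqn_leq pos // (leq_trans _ h0) // hm.
move: hs; rewrite big_nat_recl //.
have : (\sum_(0 <= j < n) 1 <= \sum_(0 <= j < n) h j.+1)%N.
  by rewrite !big_mkord; apply: leq_sum => j _; apply: pos.
rewrite sum_nat_const_nat; lia.
Qed.

Section SpanStep.
Variables (n L : nat) (h : nat -> nat).
Hypothesis hh : heights n.+1 L h.
Local Notation X := ('X_(ord_max : 'I_n.+1) : {mpoly rat[n.+1]}).
Local Notation wd := (widen_ord (leqnSn n)).
Local Notation J := (hideal n.+1 h).

Lemma esymS_hideal (T : {set 'I_n.+1}) d : (0 < d)%N ->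
  (#|T| < d + \sum_(n.+1 - #|T| <= j < n.+1) h j)%N -> J (esymS d T).
Proof. by move=> d0 lt; apply: mem_ideal_gen; exists T, d. Qed.

Lemma sum_top m : (m <= n)%N ->
  (\sum_(n - m <= j < n.+1) h j = h (n - m) + \sum_(n.+1 - m <= j < n.+1) h j)%N.
Proof. by move=> mn; rewrite big_ltn ?ltnS ?leq_subr // subSn. Qed.

(** Multiplying by [X ^+ i] shifts the degree of an elementary symmetric
    polynomial by [i] when the height of the relevant column is at most [i]. *)
Lemma telescope_hideal (S : {set 'I_n}) i d : (0 < d + i)%N -> (h (n - #|S|) <= i)%N ->
  (#|S| < d + \sum_(n - #|S| <= j < n.+1) h j)%N -> J (X ^+ i * esymS d (wd @: S)).
Proof.
move=> di hi lt.
have injw : injective wd by move=> x y /(congr1 val) /= /val_inj.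
have Sn : (#|S| <= n)%N by rewrite -[n in (_ <= n)%N]card_ord max_card.
apply: telescope_mem => [r /andP[r0 ri]|].
  apply: esymS_hideal; first by rewrite addn_gt0 r0 orbT.
  have arith m s : (m < d + s)%N -> (m.+1 < d + r + s)%N by lia.
  by rewrite cardsU1 ord_max_widen card_imset //= add1n subSS; apply: arith.
apply: esymS_hideal; rewrite ?card_imset //.
have arith m s u : (u <= i)%N -> (m < d + (u + s))%N -> (m < d + i + s)%N by lia.
by apply: arith hi _; rewrite -sum_top.
Qed.

Section OneHeight.
Variables (h' : nat -> nat) (i : nat).

(** If every generator for [n] variables can be moved into [J] up to higher
    powers of [X], then so can the whole ideal. *)
Lemma lift_ideal :
  (forall g, hgens h' g -> exists z, J (X ^+ i * mwiden g - X ^+ i.+1 * z)) ->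
  forall f, hideal n h' f -> exists z, J (X ^+ i * mwiden f - X ^+ i.+1 * z).
Proof.
move=> hg f [s sG ->]; elim: s sG => [|[q g] s IH] sG.
  by exists 0; rewrite big_nil raddf0 !mulr0 subrr; apply: ideal_mem0.
have [|z1 Jz1] := IH; first by move=> cg cs; apply: sG; rewrite inE cs orbT.
have [|z2 Jz2] := hg g; first by apply: (sG (q, g)); rewrite mem_head.
exists (mwiden q * z2 + z1); rewrite big_cons raddfD /= mwidenM.
have -> : X ^+ i * (mwiden q * mwiden g + mwiden (\sum_(j <- s) j.1 * j.2))
   - X ^+ i.+1 * (mwiden q * z2 + z1) =
   mwiden q * (X ^+ i * mwiden g - X ^+ i.+1 * z2) +
   (X ^+ i * mwiden (\sum_(j <- s) j.1 * j.2) - X ^+ i.+1 * z1) by ring.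
by apply: (@ideal_memD _ J) => //; apply: ideal_memM.
Qed.
End OneHeight.

(** Appending infinity: the heights are unchanged and [i] is at least all of
    them. *)
Lemma generator_inf i : h n = 0%N -> (h 0 <= i)%N ->
  forall g, hgens h g -> J (X ^+ i * mwiden (g : {mpoly rat[n]})).
Proof.
move=> hn h0 _ [S [d [d0 lt ->]]]; rewrite mwiden_esymS; apply: telescope_hideal.
- by rewrite addn_gt0 d0.
- by apply: leq_trans h0; case: hh => hm _ _ _; apply: hm.
- by rewrite big_nat_recr ?leq_subr //= hn addn0.
Qed.

(** Appending the top of column [j], the last one of height greater than [i]: the
    heights [h'] for the first [n] positions have one box less in column [j]. *)
Lemma generator_col i j h' : (j <= n)%N -> h' n = 0%N -> (forall l, h l = h' l + (l == j))%N ->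
  (forall l, (j < l)%N -> (h l <= i)%N) ->
  forall g, hgens h' g -> exists z, J (X ^+ i * mwiden (g : {mpoly rat[n]}) - X ^+ i.+1 * z).
Proof.
move=> jn h'n hE hj _ [S [d [d0 lt ->]]]; rewrite mwiden_esymS.
have injw : injective wd by move=> x y /(congr1 val) /= /val_inj.
have Sn : (#|S| <= n)%N by rewrite -[n in (_ <= n)%N]card_ord max_card.
have sumE : (\sum_(n - #|S| <= l < n.+1) h l =
    \sum_(n - #|S| <= l < n) h' l + \sum_(n - #|S| <= l < n.+1) (l == j))%N.
  rewrite (eq_bigr _ (fun l _ => hE l)) big_split /=; congr (_ + _)%N.
  by rewrite big_nat_recr ?leq_subr //= h'n addn0.
have [jl|lj] := ltnP j (n - #|S|).
  exists 0; rewrite mulr0 subr0; apply: telescope_hideal.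
  - by rewrite addn_gt0 d0.
  - exact: hj.
  - by rewrite sumE addnA ltn_addr.
case: d d0 lt => // d _ lt; exists (- esymS d (wd @: S)).
have -> : X ^+ i * esymS d.+1 (wd @: S) - X ^+ i.+1 * - esymS d (wd @: S) =
   X ^+ i * esymS d.+1 (ord_max |: wd @: S) by rewrite esymS_max exprSr; ring.
apply/ideal_memM/esymS_hideal => //.
rewrite cardsU1 ord_max_widen card_imset //= add1n subSS sumE.
have -> : (\sum_(n - #|S| <= l < n.+1) (l == j) = 1)%N.
  rewrite (bigD1_seq j) ?iota_uniq ?mem_index_iota ?lj //= eqxx big1 // => l.
  by move/negbTE ->.
have arith m s : (m < d.+1 + s)%N -> (m.+1 < d.+1 + (s + 1))%N by lia.
exact: arith.
Qed.
End SpanStep.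

Lemma stair_set_inf n L h m i :
  @stair_set n L h m -> @stair_set n.+1 L h (mnm_ext m i).
Proof.
move=> [c [sc cL ch] cm]; exists (rcons c L).
  split; first by rewrite size_rcons sc.
    by rewrite all_rcons leqnn cL.
  move=> j jL; rewrite -cats1 count_cat /= addn0 ch //.
  by rewrite [L == j]gtn_eqF // addn0.
move=> k; case: (ord_maxVwiden k) => [->|[l ->]].
  by rewrite nth_rcons sc ltnn eqxx ltnn.
rewrite /= nth_rcons sc ltn_ord => lt; rewrite mnm_ext_widen.
by rewrite -cats1 takel_cat ?sc ?(ltnW (ltn_ord l)) //; apply: cm.
Qed.

Lemma stair_set_col n L h h' j m i : (j < L)%N ->
  (forall l, h l = h' l + (l == j))%N -> (i < h j)%N ->
  @stair_set n L h' m -> @stair_set n.+1 L h (mnm_ext m i).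
Proof.
move=> jL hE ij [c [sc cL ch] cm]; exists (rcons c j).
  split; first by rewrite size_rcons sc.
    by rewrite all_rcons ltnW.
  by move=> l lL; rewrite -cats1 count_cat /= addn0 ch // hE [j == l]eq_sym.
move=> k; case: (ord_maxVwiden k) => [->|[l ->]].
  rewrite mnm_ext_max /= nth_rcons sc ltnn eqxx => _.
  rewrite -cats1 -sc take_size_cat // ch // -ltnS.
  by have := hE j; rewrite eqxx addn1 => <-.
rewrite /= nth_rcons sc ltn_ord => lt; rewrite mnm_ext_widen.
by rewrite -cats1 takel_cat ?sc ?(ltnW (ltn_ord l)) //; apply: cm.
Qed.

(** Modulo the ideal, every polynomial is a combination of the monomials below
    the staircases.  A monomial is treated by induction on the number of
    variables and, for a fixed number, by decreasing induction on the exponent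
    [i] of the last variable; the last letter of the staircase is taken from the
    last column of height greater than [i], or is infinite when there is none. *)
Lemma span_stairs L n h : heights n L h ->
  forall f, span_mod (stair_set L h) (hideal n h) f.
Proof.
elim: n h => [|n IH] h hh.
  move=> f; exists f; last by rewrite subrr; apply: ideal_mem0.
  move=> m _; exists [::]; last by case.
  by split=> // j _; case: hh => _ _ h0 _; rewrite h0.
set X : {mpoly rat[n.+1]} := 'X_ord_max.
set Sp := span_mod _ _.
have [hm hL hn hs] := hh.
have ext h' i (g : {mpoly rat[n]}) :
    (forall m, @stair_set n L h' m -> @stair_set n.+1 L h (mnm_ext m i)) ->
    (forall m, m \in msupp g -> stair_set L h' m) -> Sp (X ^+ i * mwiden g).
  move=> hC gC; rewrite [g]mpolyE raddf_sum mulr_sumr big_seq; apply: span_mod_sum => m mg /=.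
  rewrite mwidenZ -scalerAr -mpolyX_ext; apply/span_modZ/span_modX/hC/gC/mg.
(* No column has height greater than [i].  Either infinity is available, or the
   heights have total [n.+1] and [X ^+ i] is in the ideal. *)
have big i f0 : (h 0 <= i)%N -> Sp (X ^+ i * mwiden f0).
  move=> h0i; have [hsn|hsn] := leqP (\sum_(0 <= j < n.+1) h j) n.
    have h_n : h n = 0%N.
      apply/eqP; rewrite -leqn0 leqNgt; apply/negP => hn0; have h1 := heights_last hh hn0.
      move: hsn; rewrite big_mkord (eq_bigr (fun=> 1%N)) => [|j _]; last by rewrite h1 // -ltnS.
      by rewrite sum1_card card_ord ltnn.
    have hh' : heights n L h.
      split=> // [j|]; first by rewrite leq_eqVlt => /predU1P[<- //|/hn].
      by move: hsn; rewrite big_nat_recr //= h_n addn0.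
    have [g gC [s sG e]] := IH h hh' f0.
    rewrite -[f0](subrK g) addrC raddfD mulrDr; apply: span_modD.
      by apply: ext gC => m; apply: stair_set_inf.
    apply: span_mod_ideal; rewrite e raddf_sum mulr_sumr big_seq.
    apply: (@ideal_mem_sum _ (hideal n.+1 h)) => -[q r] /sG /= rG; rewrite mwidenM mulrCA; apply: (@ideal_memM _ (hideal n.+1 h)).
    exact: (generator_inf hh h_n h0i rG).
  apply: span_mod_ideal; rewrite mulrC; apply: ideal_memM.
  have h0 : (0 < h 0)%N.
    rewrite lt0n; apply: contraTneq hsn => h0; rewrite -leqNgt big_mkord big1 // => j _.
    by apply/eqP; rewrite -leqn0 -h0 hm.
  have := @telescope_hideal n h setT i 0; rewrite cardsT card_ord subnn add0n.
  rewrite esymSE esum0 mulr1; apply=> //; exact: leq_trans h0i.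
(* Remove the top box of the last column of height greater than [i]. *)
have small i f0 : (i < h 0)%N -> exists z, Sp (X ^+ i * mwiden f0 - X ^+ i.+1 * z).
  move=> ih0; have exj : exists j, (i < h j)%N by exists 0%N.
  have bj j : (i < h j)%N -> (j <= n)%N.
    by move=> ij; rewrite leqNgt; apply/negP => /hn hj0; rewrite hj0 in ij.
  case: (ex_maxnP exj bj) => j ij jmax.
  pose h' l := (h l - (l == j))%N.
  have hE l : h l = (h' l + (l == j))%N.
    by rewrite /h'; case: eqP => [->|_]; rewrite ?addn0 ?subn0 // subnK // (leq_ltn_trans _ ij).
  have jL : (j < L)%N by rewrite ltnNge; apply/negP => /hL hj; rewrite hj in ij.
  have jn := bj j ij.
  have jlt l : (j < l)%N -> (h l <= i)%N.
    by move=> jl; rewrite leqNgt; apply/negP => /jmax; rewrite leqNgt jl.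
  have h'n : h' n = 0%N.
    rewrite /h'; have [hn0|hn0] := leqP (h n) 0; first by move: hn0; rewrite leqn0 => /eqP ->.
    have h1 := heights_last hh hn0; rewrite h1 //.
    suff -> : n == j by [].
    by rewrite eqn_leq jn andbT; apply: jmax; move: ij; rewrite !h1.
  have hh' : heights n L h'.
    split.
    - move=> a b ab; rewrite /h'; have hba := hm a b ab.
      case: (eqVneq a j) => [aj|_]; last by rewrite subn0 (leq_trans (leq_subr _ _)).
      case: (eqVneq b j) => [bj'|bj']; first by rewrite bj' aj.
      have jb : (j < b)%N by rewrite ltn_neqAle eq_sym bj' -aj.
      have := jlt b jb; rewrite subn0 aj; move: ij; lia.
    - by move=> l /hL hl; rewrite /h' hl.
    - move=> l; rewrite leq_eqVlt => /predU1P[<- //|/hn hl]; by rewrite /h' hl.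
    - have : (\sum_(0 <= l < n.+1) h l = \sum_(0 <= l < n) h' l + 1)%N.
        rewrite (eq_bigr _ (fun l _ => hE l)) big_split /= big_nat_recr //= h'n addn0; congr (_ + _)%N.
        rewrite (bigD1_seq j) ?iota_uniq ?mem_index_iota //= eqxx big1 // => l.
        by move/negbTE ->.
      by move=> e; move: hs; rewrite e addn1 ltnS.
  have [g gC Jr] := IH h' hh' f0.
  have [z Jz] := @lift_ideal n h h' i (generator_col jn h'n hE jlt) _ Jr.
  exists z; have -> : X ^+ i * mwiden f0 - X ^+ i.+1 * z =
    X ^+ i * mwiden g + (X ^+ i * mwiden (f0 - g) - X ^+ i.+1 * z) by rewrite raddfB; ring.
  apply: span_modD; last exact: span_mod_ideal.
  by apply: ext gC => m; apply: (stair_set_col jL hE ij).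
have all_ t i f : (h 0 <= i + t)%N -> Sp (X ^+ i * f).
  elim: t i f => [|t IHt] i f.
    rewrite addn0 => h0i; apply: (@span_mod_linear _ _ _ (fun f => X ^+ i * f)).
      by move=> a p q; rewrite mulrDr scalerAr.
    move=> m; have [m' ->] := mnm_extP m; rewrite mpolyX_ext mulrA -exprD.
    by apply: big; apply: leq_trans h0i (leq_addr _ _).
  move=> h0it; have [h0i|ih0] := leqP (h 0) i; first by apply: IHt; apply: leq_trans h0i (leq_addr _ _).
  have [f0 [f1 ->]] := widen_decomp f; have [z Sz] := small i f0 ih0.
  have -> : X ^+ i * (mwiden f0 + X * f1) =
     (X ^+ i * mwiden f0 - X ^+ i.+1 * z) + X ^+ i.+1 * (z + f1) by rewrite exprSr; ring.
  by apply: span_modD => //; apply: IHt; rewrite addSnnS.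
by move=> f; have := all_ (h 0%N) 0%N f (leqnn _); rewrite expr0 mul1r.
Qed.

(** * Partitions, shuffles and labels *)

Lemma sum_count_ltn (s : seq nat) d :
  (\sum_(0 <= j < d) count (fun r => j < r)%N s = \sum_(r <- s) minn d r)%N.
Proof.
under eq_bigr do rewrite -sum1_count big_mkcond.
rewrite exchange_big /=; apply: eq_bigr => r _.
elim: d => [|d IH]; first by rewrite big_geq // min0n.
rewrite big_nat_recr //= IH; case: ltnP => dr; lia.
Qed.

(** The equality also holds for [j] beyond the largest part, where both sides
    are zero. *)
Lemma nth_conj_part (la : seq nat) j : sorted geq la ->
  nth 0%N (conj_part la) j = count (fun r => j < r)%N la.
Proof.
move=> sla; rewrite /conj_part; have [jl|lj] := ltnP j (head 0%N la); first by rewrite nth_mkseq.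
rewrite nth_default ?size_mkseq //; apply/esym/eqP; rewrite eqn0Ngt -has_count -all_predC.
case: la sla lj => //= x la; rewrite path_sortedE => [/andP[xla _]|]; last first.
  by move=> a b c ab bc; apply: leq_trans bc ab.
move=> xj; rewrite -leqNgt xj /=; apply/allP => y /(allP xla) /= yx.
by rewrite -leqNgt (leq_trans yx).
Qed.

Lemma conj_part_sorted la : sorted geq (conj_part la).
Proof.
apply: (homo_sorted (e := leq)); last exact: iota_sorted.
by move=> i j ij /=; apply: sub_count => r; apply: leq_ltn_trans.
Qed.

Lemma heights_conj_part n k la : (k <= n)%N -> is_partition k la ->
  heights n (size (conj_part la)) (nth 0%N (conj_part la)).
Proof.
move=> kn /and3P[sla _ /eqP sk].
have Ln : (size (conj_part la) <= n)%N.
  rewrite size_mkseq; apply: leq_trans kn; rewrite -sk.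
  by case: la {sla sk} => //= x la; apply: leq_addr.
split.
- by move=> i j ij; rewrite !nth_conj_part //; apply: sub_count => r; apply: leq_ltn_trans.
- by move=> j jL; rewrite nth_default.
- by move=> j nj; rewrite nth_default // (leq_trans Ln).
under eq_bigr do rewrite nth_conj_part //.
rewrite sum_count_ltn; apply: leq_trans kn; rewrite -sk sumnE.
by apply: leq_sum => r _; apply: geq_minr.
Qed.

Lemma sum_conj_part k la : is_partition k la ->
  (\sum_(j < size (conj_part la)) nth 0%N (conj_part la) j = k)%N.
Proof.
move=> /and3P[sla _ /eqP sk]; rewrite -(big_mkord predT (nth 0%N (conj_part la))).
under eq_bigr do rewrite nth_conj_part //.
rewrite sum_count_ltn -sk sumnE; apply: eq_big_seq => r rla; apply/minn_idPr.
rewrite size_mkseq; case: la sla rla {sk} => //= x la; rewrite path_sortedE => [/andP[xla _]|]; last first.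
  by move=> a b c ab bc; apply: leq_trans bc ab.
by rewrite inE => /predU1P[->|/(allP xla)].
Qed.

Lemma sum_conj_conj la d :
  (\sum_(j < d) nth 0%N (conj_part (conj_part la)) j =
   \sum_(j < size (conj_part la)) minn d (nth 0%N (conj_part la) j))%N.
Proof.
rewrite -(big_mkord predT (nth 0%N (conj_part (conj_part la)))).
under eq_bigr do rewrite (nth_conj_part _ (conj_part_sorted la)).
by rewrite sum_count_ltn (big_nth 0%N) big_mkord.
Qed.

(** The word spelled by a sequence of labels: the entry at a position is the
    number of earlier positions with the same label, or infinity. *)
Definition label_word (L : nat) (c : seq nat) : seq (option nat) :=
  mkseq (fun i => if (nth 0 c i < L)%N then Some (count_mem (nth 0%N c i) (take i c)) else None)
    (size c).

Lemma label_word_rcons L c x : label_word L (rcons c x) =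
  rcons (label_word L c) (if (x < L)%N then Some (count_mem x c) else None).
Proof.
rewrite /label_word size_rcons /mkseq -[X in iota 0 X]addn1 iotaD map_cat /= cats1 add0n.
rewrite nth_rcons ltnn eqxx -(cats1 c x) take_size_cat //; congr rcons.
apply/eq_in_map => i; rewrite mem_iota /= add0n => ic.
by rewrite nth_cat ic takel_cat // ltnW.
Qed.

Lemma mask_label_word L c j :
  mask [seq i == j | i <- c] (label_word L c) =
  if (j < L)%N then [seq Some a | a <- iota 0 (count_mem j c)] else nseq (count_mem j c) None.
Proof.
elim/last_ind: c => [|c x IH]; first by case: ifP.
rewrite label_word_rcons map_rcons mask_rcons  ?size_map ?size_iota // IH.
rewrite -cats1 count_cat /= addn0; case: eqP => [->|_]; last by rewrite addn0 cats0.
by case: ifP => _; rewrite ?iotaD ?map_cat // nseqD.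
Qed.

(** The entry of [s] selected at position [i] is found in the mask at the number
    of selections made before [i]. *)
Lemma nth_mask_count (T : Type) (x0 : T) (m : bitseq) (s : seq T) i :
  size m = size s -> nth false m i -> nth x0 (mask m s) (count id (take i m)) = nth x0 s i.
Proof.
elim: m s i => [|b m IH] [|x s] i //=; first by rewrite nth_nil.
case=> sz; case: i => [/= ->|i mi] //=.
by case: b {mi} (IH s i sz mi) => /= <-; rewrite ?add1n ?add0n.
Qed.

(** A shuffle is determined by its sequence of labels, the last label being that
    of infinity. *)
Lemma staircase_labels n k la (g : seq (option nat)) : (k <= n)%N -> is_partition k la ->
  size g = n ->
  is_staircase n la g <->
  exists2 c, stair_labels n (size (conj_part la)) (nth 0%N (conj_part la)) c
    & g = label_word (size (conj_part la)) c.
Proof.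
move=> kn hla sg; set L := size _; set h := nth 0%N _.
pose ss := rcons [seq [seq Some a | a <- iota 0 l] | l <- conj_part la] (nseq (n - sumn la) None).
have sss : size ss = L.+1 by rewrite size_rcons size_map.
have ss_fin j : (j < L)%N -> nth [::] ss j = [seq Some a | a <- iota 0 (h j)].
  by move=> jL; rewrite nth_rcons size_map jL (nth_map 0%N).
have ss_inf : nth [::] ss L = nseq (n - sumn la) None by rewrite nth_rcons size_map ltnn eqxx.
have cmask j c : count id [seq i == j | i <- c] = count_mem j c by rewrite count_map; apply: eq_count.
split=> [[c [sc cL cm]]|[c [sc cL ch] ->]].
  rewrite -/ss sss in cL cm; exists c.
    split; [by rewrite sc| |].
      by apply: sub_all cL => j; rewrite ltnS.
    move=> j jL; rewrite -cmask -(@size_mask _ _ g) ?size_map // cm ?ltnS ?(ltnW jL) //.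
    by rewrite ss_fin // size_map size_iota.
  apply: (@eq_from_nth _ None) => [|i ig]; first by rewrite size_mkseq sc.
  rewrite nth_mkseq ?sc //.
  have jL : (nth 0%N c i < L.+1)%N by have /allP := cL; apply; apply: mem_nth; rewrite sc.
  set j := nth 0%N c i in jL *.
  have mi : nth false [seq l == j | l <- c] i by rewrite (nth_map 0%N) ?sc.
  have := @nth_mask_count _ None [seq l == j | l <- c] g i _ mi.
  rewrite size_map sc -map_take cmask cm // => /(_ erefl) <-.
  have szj : size (nth [::] ss j) = count_mem j c.
    by rewrite -cm // size_mask ?size_map ?sc // cmask.
  case: ltnP => jL'; last first.
    have -> : j = L by apply/eqP; rewrite eqn_leq -ltnS jL.
    by rewrite ss_inf nth_nseq; case: ifP.
  have lt : (count_mem j (take i c) < h j)%N.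
    rewrite ss_fin // size_map size_iota in szj; rewrite szj.
    rewrite -[X in (_ < count _ X)%N](cat_take_drop i c) count_cat.
    by rewrite (drop_nth 0%N) ?sc //= -/j eqxx -ltnS addnS ltnS leq_addr.
  by rewrite ss_fin // (nth_map 0%N) ?size_iota // nth_iota.
exists c; rewrite -/ss sss; split; first by rewrite size_mkseq.
  by apply: sub_all cL => j; rewrite ltnS.
move=> j; rewrite ltnS leq_eqVlt mask_label_word => /predU1P[->|jL]; last by rewrite jL ch // ss_fin.
rewrite ltnn ss_inf; congr nseq.
have tot : (\sum_(j < L.+1) count_mem (j : nat) c = n)%N.
  have cE (j0 : nat) : count_mem j0 c = (\sum_(x <- c) (x == j0))%N.
    by rewrite -sum1_count big_mkcond.
  rewrite (eq_bigr (fun j0 : 'I_L.+1 => \sum_(x <- c) (x == j0 :> nat))%N) => [|j0 _]; last exact: cE.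
  rewrite exchange_big /= -sc -[RHS]sum1_size big_seq [RHS]big_seq; apply: eq_bigr => x xc.
  have xL : (x < L.+1)%N by have /allP := cL; apply.
  rewrite (bigD1 (Ordinal xL)) //= eqxx big1 // => l; rewrite -val_eqE /= eq_sym.
  by move/negbTE ->.
move: tot; rewrite big_ord_recr /= (eq_bigr (fun j : 'I_L => h j)) => [|l _]; last exact: ch.
rewrite (sum_conj_part hla) => <-; case/and3P: hla => _ _ /eqP <-.
by rewrite addKn.
Qed.

Lemma C_set_stair n k la (a : 'X_{1..n}) : (k <= n)%N -> is_partition k la ->
  C_set la a <-> stair_set (size (conj_part la)) (nth 0%N (conj_part la)) a.
Proof.
move=> kn hla; set L := size _; set h := nth 0%N _.
split=> [[g gst ag]|[c cl ca]].
  have [/(_ gst)[c cl ge] _] := staircase_labels kn hla (size_tuple g); exists c => //.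
  case: cl => sc _ _ i; have := ag i; rewrite (tnth_nth None) ge nth_mkseq ?sc //.
  by case: ltnP.
have sw : size (label_word L c) == n by rewrite size_mkseq; case: cl => ->.
exists (Tuple sw); first by apply/(staircase_labels kn hla) => //=; [exact/eqP|exists c].
move=> i; rewrite (tnth_nth None) /= nth_mkseq; last by case: cl => -> _ _.
by have := ca i; case: ltnP => //= _; apply.
Qed.

(** * The isomorphism *)

Section QuotientMap.
Variables (K : fieldType) (A B : comAlgType K) (I : ideal A) (J : ideal B).

(** The map of quotients induced by a ring morphism carrying [I] into [J]. *)
Definition quot_map (phi : {rmorphism A -> B}) (phiIJ : forall x, I x -> J (phi x))
  (q : quot_alg I) : quot_alg J := quot_pi J (phi (quot_repr q)).

Variables (phi : {rmorphism A -> B}) (phiIJ : forall x, I x -> J (phi x)).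

Lemma quot_map_pi x : quot_map phiIJ (quot_pi I x) = quot_pi J (phi x).
Proof.
by apply/quot_piP; rewrite -rmorphB; apply: phiIJ; apply/quot_piP; rewrite quot_reprK.
Qed.

Lemma quot_map_is_zmod_morphism : zmod_morphism (quot_map phiIJ).
Proof.
move=> p q; rewrite -(quot_reprK p) -(quot_reprK q) -raddfB !quot_map_pi.
by rewrite rmorphB raddfB.
Qed.

Lemma quot_map_is_monoid_morphism : monoid_morphism (quot_map phiIJ).
Proof.
split=> [|p q]; first by rewrite -(rmorph1 (quot_pi I)) quot_map_pi !rmorph1.
by rewrite -(quot_reprK p) -(quot_reprK q) -rmorphM !quot_map_pi !rmorphM.
Qed.

HB.instance Definition _ := GRing.isZmodMorphism.Build (quot_alg I) (quot_alg J)
  (quot_map phiIJ) quot_map_is_zmod_morphism.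
HB.instance Definition _ := GRing.isMonoidMorphism.Build (quot_alg I) (quot_alg J)
  (quot_map phiIJ) quot_map_is_monoid_morphism.

Lemma quot_map_scalable : scalable phi -> scalable (quot_map phiIJ).
Proof.
move=> sc c q; rewrite -(quot_reprK q) -linearZ /= !quot_map_pi sc.
by rewrite [RHS]quot_pi_scale.
Qed.
End QuotientMap.

(** The inclusion of the coordinate ring of the diagonal matrices. *)
Definition diag_incl n : {rmorphism {mpoly rat[n]} -> {mpoly rat[n * n]}} :=
  mmap (@mpolyC (n * n) rat) (fun i => glvar i i).

Lemma diag_inclX n (i : 'I_n) : diag_incl n 'X_i = glvar i i.
Proof. by rewrite /diag_incl /= mmapX mmap1U. Qed.

Lemma diag_inclZ n : scalable (diag_incl n).
Proof. by move=> c p; rewrite /diag_incl /= mmapZ mul_mpolyC. Qed.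

Lemma diag_restr_glvar n (i j : 'I_n) : diag_restr n (glvar i j) = if i == j then 'X_i else 0.
Proof. by rewrite /diag_restr mxeval_glvar !mxE; case: eqP => [->|_]; rewrite ?mulr0n. Qed.

Lemma mpoly_morph_eq n (A : nzRingType) (phi psi : {rmorphism {mpoly rat[n]} -> A}) :
  (forall c, phi c%:MP = psi c%:MP) -> (forall i, phi 'X_i = psi 'X_i) -> phi =1 psi.
Proof.
move=> hC hX; elim/mpolyind => [|c m p _ _ IH]; first by rewrite !raddf0.
rewrite !raddfD /= IH -mul_mpolyC !rmorphM /= hC mpolyXE_id !rmorph_prod.
congr (_ * _ + _); apply: eq_bigr => i _; by rewrite !rmorphXn hX.
Qed.

Lemma diag_inclK n : cancel (diag_incl n) (diag_restr n).
Proof.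
move=> p; apply: (@mpoly_morph_eq n _ (diag_restr n \o diag_incl n) idfun) => [c|i].
  by rewrite /= !mmapC.
by rewrite /= -/(diag_incl n 'X_i) diag_inclX diag_restr_glvar eqxx.
Qed.

Lemma mxeval_generic n f : mxeval (@mpolyC (n * n) rat) (generic_mx n) f = f.
Proof.
apply: (@mpoly_morph_eq _ _ (mxeval (@mpolyC (n * n) rat) (generic_mx n)) idfun) => [c|e].
  by rewrite /= mmapC.
by case/mxvec_indexP: e => i j; rewrite -[LHS]/(mxeval _ _ (glvar i j)) mxeval_glvar mxE.
Qed.

(** The generic matrix is congruent to its diagonal part modulo the ideal of the
    diagonal matrices. *)
Lemma diag_restr_congr n f : diag_ideal n (f - diag_incl n (diag_restr n f)).
Proof.
pose io : {rmorphism rat -> {mpoly rat[n * n]}} := @mpolyC (n * n) rat.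
rewrite -{1}(mxeval_generic f) (@rmorph_mxeval _ _ _ _ io (diag_incl n)); last first.
  by move=> c; rewrite /= mmapC.
apply: ideal_congr_mxeval => i j; rewrite !mxE.
have [->|ij] := eqVneq i j; first by rewrite mulr1n diag_inclX subrr; apply: (ideal_mem0 (diag_ideal n)).
by rewrite mulr0n raddf0 subr0; apply: mem_ideal_gen; exists i, j.
Qed.

Lemma diag_restr_ideal n f : diag_ideal n f -> diag_restr n f = 0.
Proof.
move=> [s sG ->]; rewrite raddf_sum big_seq big1 // => -[q g] /sG /= [i [j [ij ->]]].
by rewrite (rmorphM (diag_restr n)) diag_restr_glvar (negbTE ij) mulr0.
Qed.

Section Trace.
Variables (n : nat) (V : 'M[rat]_n -> Prop).

(** Restrictions to the diagonal of the polynomials vanishing on [V]. *)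
Definition trace_mem (g : {mpoly rat[n]}) : Prop :=
  exists2 f, vanishing_ideal V f & diag_restr n f = g.

Lemma trace_mem0 : trace_mem 0.
Proof. by exists 0; [apply: ideal_mem0|rewrite raddf0]. Qed.

Lemma trace_memD x y : trace_mem x -> trace_mem y -> trace_mem (x + y).
Proof.
move=> [f Vf <-] [g Vg <-]; exists (f + g); last by rewrite raddfD.
exact: (ideal_memD Vf Vg).
Qed.

Lemma trace_memM a x : trace_mem x -> trace_mem (a * x).
Proof.
move=> [f Vf <-]; exists (diag_incl n a * f); last by rewrite (rmorphM (diag_restr n)) diag_inclK.
exact: (ideal_memM _ Vf).
Qed.

Definition trace_ideal : ideal {mpoly rat[n]} :=
  Ideal trace_mem0 trace_memD trace_memM.
End Trace.

Lemma OT_idealE n mu f :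
  OT_ideal n mu f <-> trace_ideal (@rank_variety n mu) (diag_restr n f).
Proof.
split=> [[y [z [Vy Dz ->]]]|[g Vg e]].
  exists y; first exact: Vy.
  by rewrite (rmorphD (diag_restr n)) (diag_restr_ideal Dz) addr0.
exists g, (f - g); split; [exact: Vg| |by rewrite addrC subrK].
have := diag_restr_congr (f - g); rewrite (rmorphB (diag_restr n)) e.
by rewrite subrr raddf0 subr0.
Qed.

Section Main.
Variables (n k : nat) (la : seq nat).
Hypotheses (kn : (k <= n)%N) (hla : is_partition k la).
Local Notation L := (size (conj_part la)).
Local Notation h := (nth 0%N (conj_part la)).
Local Notation V := (@rank_variety n (conj_part la)).

Let hh : heights n L h. Proof. exact: heights_conj_part kn hla. Qed.

Lemma rank_varietyE (X : 'M[rat]_n) : V X <->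
  forall d, (1 <= d <= n)%N -> (\rank (X ^+ d)%R + \sum_(j < L) minn d (h j) <= n)%N.
Proof.
have rn d : (\rank (X ^+ d)%R <= n)%N by apply: rank_leq_row.
split=> H d dn; move: (H d dn); rewrite mxrank_coker sum_conj_conj; have := rn d; lia.
Qed.

(** The number imposed by the rank condition of exponent [h q] exceeds [q * h q]
    by the total height of the columns from [q] on. *)
Lemma sum_heights_tail q : (q <= n)%N ->
  (\sum_(j < L) minn (h q) (h j) = q * h q + \sum_(q <= j < n) h j)%N.
Proof.
move=> qn; have [hm hL hn _] := hh.
have -> : (\sum_(j < L) minn (h q) (h j) = \sum_(0 <= j < n) minn (h q) (h j))%N.
  have [Ln|nL] := leqP L n.
    rewrite -(big_mkord predT (fun j => minn (h q) (h j))) [RHS](big_cat_nat _ Ln) //=.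
    rewrite [X in (_ + X)%N]big_nat_cond [X in (_ + X)%N]big1 ?addn0 // => j /andP[/andP[Lj _] _].
    by rewrite (hL _ Lj) minn0.
  rewrite -(big_mkord predT (fun j => minn (h q) (h j))) [LHS](big_cat_nat _ (ltnW nL)) //=.
  rewrite [X in (_ + X)%N]big_nat_cond [X in (_ + X)%N]big1 ?addn0 // => j /andP[/andP[nj _] _].
  by rewrite (hn _ nj) minn0.
rewrite (big_cat_nat _ qn) //=; congr (_ + _)%N; last first.
  rewrite big_nat_cond [RHS]big_nat_cond; apply: eq_bigr => j /andP[/andP[qj _] _].
  by apply/minn_idPr/hm.
rewrite big_nat_cond (eq_bigr (fun=> h q)) => [|j /andP[/andP[_ jq] _]]; last first.
  by apply/minn_idPl/hm/ltnW.
by rewrite -big_nat_cond sum_nat_const_nat subn0.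
Qed.

Lemma I_ideal_trace g : I_ideal n la g -> trace_ideal V g.
Proof.
apply: ideal_gen_sub => _ [S [d [d0 lt ->]]].
have Sn : (#|S| <= n)%N by rewrite -[n in (_ <= n)%N]card_ord max_card.
have [Sd|dS] := ltnP #|S| d.
  by rewrite esymSE esum_gt //; apply: (ideal_mem0 (trace_ideal V)).
have [hm _ _ hs] := hh.
rewrite /pnm in lt; set q := (n - #|S|)%N in lt.
have qn : (q <= n)%N by apply: leq_subr.
have pos : (0 < h q)%N.
  rewrite lt0n; apply: contraTneq dS => hq0; rewrite -ltnNge; move: lt.
  rewrite big_nat_cond big1 ?addn0 // => j /andP[/andP[qj _] _].
  by apply/eqP; rewrite -leqn0; have := hm _ _ qj; rewrite hq0.
have hqn : (h q <= n)%N.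
  have n0 : (0 < n)%N.
    by have [_ _ hn _] := hh; rewrite lt0n; apply: contraTneq pos => n0; rewrite hn ?n0.
  by apply: leq_trans (hm 0%N q isT) _; apply: leq_trans hs; rewrite big_ltn // leq_addr.
have -> : esymS d S = (-1) ^+ d * diag_restr n (minor_sum S d).
  by rewrite diag_restr_minor_sum // mulrA -expr2 sqrr_sign mul1r.
apply: trace_memM; exists (minor_sum S d) => // X /rank_varietyE VX.
apply: (@gleval_minor_sum n X S (h q)) => //; first exact: leq_trans dS Sn.
have := VX (h q); rewrite pos hqn sum_heights_tail // => /(_ isT).
rewrite -/q [(h q * q)%N]mulnC.
have arith a r b s : (a + q = n)%N -> (a < d + s)%N -> (r + (b + s) <= n)%N -> (a + r + b < n + d)%N.
  lia.
by apply: arith => //; rewrite /q subnKC.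
Qed.

(** Every exponent in [C_set] is detected by a functional vanishing on the
    trace ideal and triangular for [ltx]. *)
Lemma C_set_functional (a : 'X_{1..n}) : C_set la a ->
  exists psi : {scalar {mpoly rat[n]}},
    [/\ forall f, trace_ideal V f -> psi f = 0, psi 'X_[a] != 0
      & forall b, psi 'X_[b] != 0 -> b = a \/ ltx b a].
Proof.
move=> /(C_set_stair a kn hla)[c [sc cL ch] ca].
(* Each occurrence of infinity gets a class of its own. *)
pose cl (i : 'I_n) := (if nth 0 c i < L then nth 0 c i else L + i)%N.
have clL i : (cl i < L)%N = (nth 0 c i < L)%N.
  by rewrite /cl; case: ifP => // _; rewrite ltnNge leq_addr.
have inf_inj i l : cl i = cl l -> (L <= cl i)%N -> i = l.
  move=> e Li; have iL : ~~ (nth 0 c i < L)%N by rewrite -clL -leqNgt.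
  have lL : ~~ (nth 0 c l < L)%N by rewrite -clL -e -leqNgt.
  by move: e; rewrite /cl (negbTE iL) (negbTE lL) => /addnI/val_inj.
have clE i j : (j < L)%N -> (cl i == j) = (nth 0 c i == j).
  move=> jL; rewrite /cl; case: ifP => // iL.
  have -> : (nth 0 c i == j) = false by apply: contraFF iL => /eqP ->.
  by rewrite gtn_eqF // (leq_trans jL) // leq_addr.
have countE j m : (j < L)%N -> (m <= n)%N ->
    count_mem j (take m c) = #|[set l : 'I_n | (cl l == j) && (l < m)%N]|.
  move=> jL mn; rewrite -sum1_count (big_nth 0%N) size_takel ?sc //.
  rewrite (big_nat_widen _ _ _ _ _ mn) big_mkord -sum1dep_card.
  apply: eq_bigl => l /=; rewrite clE //; case: ltnP => lm; rewrite ?andbF // nth_take //.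
have colh j : (j < L)%N -> #|column cl j| = h j.
  move=> jL; rewrite -ch // -[c in RHS](take_size) sc countE //.
  by apply: eq_card => l; rewrite !inE ltn_ord andbT.
have rkE i : (cl i < L)%N -> crank cl i = count_mem (nth 0%N c i) (take i c).
  move=> iL; rewrite countE -?clL // ?(ltnW (ltn_ord i)) //.
  have -> : nth 0%N c i = cl i by rewrite /cl -clL iL.
  by [].
pose g : 'X_{1..n} := [multinom (if (cl i < L)%N then crank cl i else a i) | i < n].
have gst : is_stair_exp L cl g by move=> i iL; rewrite mnmE iL.
have ag : (a <= g)%MM.
  apply/mnm_lepP => i; rewrite mnmE; case: ifP => // iL; rewrite rkE //; apply: ca.
  by rewrite -clL.
exists (stair_functional cl (g - a) g).
have [psia psib] := stair_functional_triangular inf_inj gst ag; split=> // f [f' Vf' <-].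
apply: (diag_restr_functional inf_inj) => [X rX|f0 CI]; last exact: (stair_functional_ideal _ gst CI).
apply: Vf'; apply/rank_varietyE => d _; apply: leq_trans (rX d).
by rewrite leq_add2l; apply: leq_sum => j _; rewrite colh.
Qed.

Lemma C_set_independent (s : seq 'X_{1..n}) (c : 'X_{1..n} -> rat) :
  uniq s -> (forall m, m \in s -> C_set la m) ->
  trace_ideal V (\sum_(m <- s) c m *: 'X_[m]) -> forall m, m \in s -> c m = 0.
Proof. exact: (triangular_independent C_set_functional). Qed.

Lemma C_set_span f : span_mod (C_set la) (I_ideal n la) f.
Proof.
have [g gC Jg] := span_stairs hh f; exists g; last exact: Jg.
by move=> m /gC /(C_set_stair m kn hla).
Qed.

(** A combination of staircase monomials congruent to [g] modulo the smaller
    ideal lies in the trace ideal, hence is zero. *)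
Lemma trace_I_ideal g : trace_ideal V g -> I_ideal n la g.
Proof.
move=> Vg; have [g0 gC Ir] := C_set_span g.
suff g00 : g0 = 0 by rewrite -[g]subr0 -g00.
have Vg0 : trace_ideal V g0.
  by rewrite -(subKr g g0); apply: ideal_memB => //; apply: I_ideal_trace.
apply/mpolyP => m; rewrite mcoeff0; have [mg|/memN_msupp_eq0 //] := boolP (m \in msupp g0).
apply: (C_set_independent (c := fun m => g0@_m) (msupp_uniq g0)) mg => [|]; first exact: gC.
by rewrite -mpolyE.
Qed.

Lemma A_set_mlead (x : {mpoly rat[n]}) : A_set la x -> x = 'X_[mlead x] /\ C_set la (mlead x).
Proof. by move=> [a aC ->]; rewrite mleadXm. Qed.

Lemma A_set_basis : represents_basis (I_ideal n la) (@A_set n la).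
Proof.
have lin (s : seq {mpoly rat[n]}) (c : {mpoly rat[n]} -> rat) : uniq s ->
    (forall x, x \in s -> A_set la x) ->
    I_ideal n la (\sum_(x <- s) c x *: x) -> forall x, x \in s -> c x = 0.
  move=> us sA Is x xs; have [xE _] := A_set_mlead (sA x xs).
  have um : uniq [seq mlead x | x <- s].
    rewrite map_inj_in_uniq // => y z ys zs e.
    by rewrite (A_set_mlead (sA y ys)).1 (A_set_mlead (sA z zs)).1 e.
  rewrite xE; apply: (C_set_independent (c := fun m => c 'X_[m]) um); last exact: map_f.
    by move=> _ /mapP[y ys ->]; have [] := A_set_mlead (sA y ys).
  rewrite big_map; apply: I_ideal_trace; move: Is; rewrite big_seq [X in _ -> ideal_mem _ X]big_seq.
  rewrite (eq_bigr (fun x => c 'X_[mlead x] *: 'X_[mlead x])) // => y ys.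
  by rewrite -(A_set_mlead (sA y ys)).1.
split=> [x y Ax Ay /quot_piP Ixy|s c us sA e|q].
- apply/eqP/negPn/negP => xy.
  have := lin [:: x; y] (fun z => if z == x then 1 else -1) _ _ _ x.
  rewrite eqxx /= !inE xy eqxx => /(_ isT); move=> H.
  have : (1 : rat) = 0.
    apply: H => // [z|]; first by rewrite !inE => /orP[]/eqP ->.
    by rewrite !big_cons big_nil eqxx eq_sym (negbTE xy) addr0 scale1r scaleN1r.
  by move/eqP; rewrite oner_eq0.
- apply: lin => //; rewrite -[X in ideal_mem _ X]subr0; apply/quot_piP.
  by rewrite raddf0 -e raddf_sum; apply: eq_bigr => x _; rewrite /= linearZ.
- have [g gC Ig] := C_set_span (quot_repr q).
  exists [seq 'X_[m] | m <- msupp g], (fun x => g@_(mlead x)); split.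
    by move=> _ /mapP[m mg ->]; exists m => //; apply: gC.
  rewrite big_map -{1}(quot_reprK q); move/quot_piP: Ig => ->.
  rewrite {1}[g]mpolyE raddf_sum; apply: eq_bigr => m _.
  by rewrite /= mleadXm linearZ.
Qed.

Lemma OT_isomorphism :
  exists f : {rmorphism R_alg n la -> OT_alg n (conj_part la)},
    [/\ bijective f,
        scalable f
      & forall i : 'I_n,
          f (quot_pi (I_ideal n la) ('X_i)%R) =
          quot_pi (OT_ideal n (conj_part la)) (glvar i i)].
Proof.
have IO x : I_ideal n la x -> OT_ideal n (conj_part la) (diag_incl n x).
  by move=> Ix; apply/OT_idealE; rewrite diag_inclK; apply: I_ideal_trace.
have OI x : OT_ideal n (conj_part la) x -> I_ideal n la (diag_restr n x).
  by move/OT_idealE/trace_I_ideal.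
exists (quot_map IO); split.
- exists (quot_map OI) => q; rewrite -(quot_reprK q) !quot_map_pi.
    by rewrite diag_inclK quot_reprK.
  apply: etrans (quot_map_pi IO _) _; apply/esym/quot_piP; exists 0, (quot_repr q - diag_incl n (diag_restr n (quot_repr q))).
  by rewrite add0r; split=> //; [apply: ideal_mem0|apply: diag_restr_congr].
- exact/quot_map_scalable/diag_inclZ.
- by move=> i; apply: etrans (quot_map_pi IO _) _; rewrite diag_inclX.
Qed.
End Main.

Theorem theorem6p5 (n k : nat) (la : seq nat) (hk : (0 < k)%N) (hkn : (k <= n)%N)
    (hla : is_partition k la) :
  represents_basis (I_ideal n la) (@A_set n la) /\
  exists f : {rmorphism R_alg n la -> OT_alg n (conj_part la)},
    [/\ bijective f,
        scalable f
      & forall i : 'I_n,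
          f (quot_pi (I_ideal n la) ('X_i)%R) =
          quot_pi (OT_ideal n (conj_part la)) (glvar i i)].
Proof.
split; [exact: A_set_basis hkn hla|exact: OT_isomorphism hkn hla].
Qed.
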